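(* Let $a_1\le\cdots\le a_c$ be positive integers such that the Boij–Söderberg decomposition of $\beta(a_1,\dots,a_c)$ has no instance of mass elimination, and let $\varepsilon$ be the number of terms in that decomposition. For an integer $a_{c+1}\ge a_c$ let $I=(f_1,\dots,f_{c+1})\subset S=\Bbbk[x_1,\dots,x_n]$ be an ideal generated by a homogeneous regular sequence with $\deg f_i=a_i$. Then there exists $N>0$ such that for all $a_{c+1}>N$: (1) the number of terms in the Boij–Söderberg decomposition of $\beta(S/I)$ is constant (independent of $a_{c+1}$); (2) the elimination order of $\beta(S/I)$ is compatible with that of $\beta(a_1,\dots,a_c)$; (3) the elimination order of $\beta(S/I)$ stabilizes; (4) the first $\varepsilon$ and the last $\varepsilon$ coefficients in the Boij–Söderberg decomposition of $\beta(S/I)$ are given by linear polynomials in $a_{c+1}$.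
   Context: Diagrams. A diagram is a finitely supported array $D=(D_{i,j})$ of rational numbers indexed by columns $i\ge 0$ and degrees $j\in\mathbb Z$. For positive integers $a_1\le\dots\le a_m$, $\beta(a_1,\dots,a_m)$ denotes the graded Betti diagram of $S/(f_1,\dots,f_m)$ for a homogeneous regular sequence $f_1,\dots,f_m$ with $\deg f_i=a_i$ in a standard graded polynomial ring $S$; explicitly $\beta(a_1,\dots,a_m)_{i,j}$ is the number of $i$-element subsets $T\subseteq\{1,\dots,m\}$ with $\sum_{t\in T}a_t=j$. In particular $\beta(S/I)=\beta(a_1,\dots,a_{c+1})$ depends only on the degrees. Pure diagrams. A degree sequence is a strictly increasing sequence of integers $\mathbf d=(d_0,\dots,d_m)$. $\pi(\mathbf d)$ is the diagram with $\pi(\mathbf d)_{i,d_i}=\prod_{k\ne i}\frac1{|d_i-d_k|}$ and all other entries $0$. Boij–Söderberg decomposition. Starting with $\beta=\beta(a_1,\dots,a_m)$, repeat: let $\mathbf d$ be the minimal degree sequence, $d_i=\min\{j:\beta_{i,j}\neq0\}$ for $0\le i\le m$; let $q>0$ be the maximal rational such that $\beta-q\pi(\mathbf d)$ has nonnegative entries; replace $\beta$ by $\beta-q\pi(\mathbf d)$; stop when $\beta=0$. This expresses $\beta(a_1,\dots,a_m)$ as an ordered sum $\sum_{s=1}^{\varepsilon}z_s\pi(\mathbf d^s)$ with $\mathbf d^1<\dots<\mathbf d^\varepsilon$ (termwise) and coefficients $z_s>0$. The elimination order of the diagram is the sequence $\mathcal E$ of length $\varepsilon$ whose $k$-th entry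 $\mathcal E_k$ is the set of positions $(i,j)$ whose entry first becomes $0$ at step $k$. Mass elimination occurs if $\#\mathcal E_k>1$ for some $k<\varepsilon$. Compatibility. When $\beta(a_1,\dots,a_c)$ has no mass elimination, write $\mathcal E(\beta(a_1,\dots,a_c))_k=\{(i_k,j_k)\}$ for $k<\varepsilon$, and, by convention, $(i_\varepsilon,j_\varepsilon)=(c,a_1+\dots+a_c)$. The elimination order of $\beta(a_1,\dots,a_{c+1})$ is compatible with that of $\beta(a_1,\dots,a_c)$ if the latter is the beginning of the former, i.e. $\mathcal E(\beta(a_1,\dots,a_{c+1}))_k=\{(i_k,j_k)\}$ for $1\le k\le\varepsilon$. Stabilization. The elimination order stabilizes means: up to the shift of degrees by $a_{c+1}$ it does not depend on $a_{c+1}$, i.e. there is a fixed finite sequence of finite sets $F_1,\dots,F_M$ of triples $(i,j,\delta)$ with $i,j\in\mathbb Z_{\ge0}$, $\delta\in\{0,1\}$, such that for all $a_{c+1}>N$ the elimination order of $\beta(a_1,\dots,a_{c+1})$ has length $M$ and its $k$-th entry is $\{(i,j+\delta a_{c+1}):(i,j,\delta)\in F_k\}$. *)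

(* Defs.v *)
From mathcomp Require Import all_boot all_order all_algebra finmap.

Set Implicit Arguments.
Unset Strict Implicit.
Unset Printing Implicit Defensive.

Import Order.TTheory GRing.Theory Num.Theory.
Local Open Scope fset_scope.
Local Open Scope ring_scope.

(* A position (i, j) is a pair (column, degree). *)
Notation position := (nat * int)%type.
Notation diagram := {fsfun position -> rat with 0}.

(* beta(a_1, ..., a_m), for a = [:: a_1; ...; a_m]: the Betti diagram of
   S/(f_1, ..., f_m), read off the Koszul resolution of a homogeneous regular
   sequence with deg f_t = a_t. *)
Definition ci_position (a : seq nat) (T : {set 'I_(size a)}) : position :=
  (#|T|, (\sum_(t in T) nth 0 a t)%N%:Z).

Definition ci_betti (a : seq nat) : diagram :=
  [fsfun x in [fset ci_position T | T in {set 'I_(size a)}]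
     => #|[set T : {set 'I_(size a)} | ci_position T == x]|%:R].

Definition degree_sequence (m : nat) (d : seq int) : bool :=
  (size d == m.+1) && sorted <%R d.

Definition pure (d : seq int) : diagram :=
  [fsfun x in [fset (i, d`_i) | i in iota 0 (size d)]
     => \prod_(k < size d | (k : nat) != x.1) `|(d`_x.1 - d`_k)%:~R|^-1].

Definition sub_pure (D : diagram) (z : rat) (d : seq int) : diagram :=
  [fsfun x in finsupp D `|` finsupp (pure d) => D x - z * pure d x].

Definition nonneg_diagram (D : diagram) : Prop := forall x, 0 <= D x.

Definition min_degree_sequence (m : nat) (D : diagram) (d : seq int) : Prop :=
  degree_sequence m d /\
  forall i, (i <= m)%N ->
    D (i, d`_i) != 0 /\ forall j, D (i, j) != 0 -> d`_i <= j.

Definition max_coefficient (D : diagram) (d : seq int) (z : rat) : Prop :=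
  [/\ 0 < z, nonneg_diagram (sub_pure D z d) &
      forall q, nonneg_diagram (sub_pure D q d) -> q <= z].

(* [bs_decomposition m D s]: the greedy algorithm in codimension m, started
   at D, stops after size s steps and its k-th step subtracts z *: pure d,
   where (z, d) is the k-th item of s. *)
Fixpoint bs_decomposition (m : nat) (D : diagram) (s : seq (rat * seq int))
    : Prop :=
  if s is (z, d) :: s' then
    [/\ min_degree_sequence m D d, max_coefficient D d z &
        bs_decomposition m (sub_pure D z d) s']
  else forall x, D x = 0.

Definition bs_coefficients (s : seq (rat * seq int)) : seq rat := unzip1 s.

(* Entry k (counted from 0) is the set of positions which become zero at step
   k + 1 of the algorithm. *)
Fixpoint elimination_order (D : diagram) (s : seq (rat * seq int))
    : seq {fset position} :=
  if s is (z, d) :: s' then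
    [fset x in finsupp D | sub_pure D z d x == 0]
      :: elimination_order (sub_pure D z d) s'
  else [::].

Definition mass_elimination (E : seq {fset position}) : Prop :=
  exists2 k, (k.+1 < size E)%N & (1 < #|` nth fset0 E k|)%N.

(* [compatible a E E']: E' extends the elimination order E of ci_betti a, the
   last entry of E being replaced by the conventional {(c, a_1 + ... + a_c)};
   it is meant for E without mass elimination. *)
Definition compatible (a : seq nat) (E E' : seq {fset position}) : bool :=
  prefix (rcons (take (size E).-1 E) [fset (size a, (sumn a)%:Z)]) E'.

(* The bool stands for delta in {0, 1}. *)
Definition shift_positions (t : nat) (F : {fset nat * nat * bool})
    : {fset position} :=
  [fset (x.1.1, (x.1.2 + nat_of_bool x.2 * t)%N%:Z) | x in F].

(* The algorithm is deterministic: a diagram has at most one decomposition. *)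
Lemma bs_decomposition_unique m D s1 s2 :
  bs_decomposition m D s1 -> bs_decomposition m D s2 -> s1 = s2.
Proof.
elim: s1 D s2 => [|[z1 d1] s1 IH] D [|[z2 d2] s2] //=.
- by move=> D0 [[_ /(_ 0%N isT)[]]]; rewrite D0 eqxx.
- by move=> [[_ /(_ 0%N isT)[+ _]] _ _] D0; rewrite D0 eqxx.
move=> [[/andP[/eqP sz1 _] min1] max1 run1] [[/andP[/eqP sz2 _] min2] max2 run2].
have ed : d1 = d2.
  apply: (@eq_from_nth _ 0) => [|i]; first by rewrite sz1 sz2.
  rewrite sz1 ltnS => /[dup] /min1[n1 le1] /min2[n2 le2].
  by apply/le_anti; rewrite le1 ?le2.
move: max1 max2 run1 run2; rewrite -{}ed => -[_ p1 m1] [_ p2 m2].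
have -> : z1 = z2 by apply/le_anti; rewrite m1 ?m2.
by move=> run1 run2; rewrite (IH _ _ run1 run2).
Qed.

(* Main.v *)
(* Write beta = sum_k z_k pi(d^k), k = 1, ..., n, for the decomposition of
   beta(a_1, ..., a_c), C = sum_k z_k, S = a_1 + ... + a_c and t = a_{c+1}.
   A sum of pure diagrams along an increasing chain of degree sequences with
   positive coefficients is its own greedy decomposition, and its elimination
   order is read off from consecutive degree sequences.  So it is enough to
   exhibit such a sum for beta(a_1, ..., a_c, t), which is beta plus beta shifted
   by one column and t degrees.  For t > S large it is
     sum_k (z_k t + y_k) pi(d^k, S + t)
     + sum_{r = c-1, ..., 1} C (d^1_r + t - d^n_r)
         pi(d^n_0, ..., d^n_r, d^1_r + t, ..., d^1_c + t)
     + sum_k (z_k t + w_k) pi(0, d^k + t).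
   The middle sum telescopes.  The constants y_k and w_k are the coordinates on
   the pi(d^k) of the diagrams with entries
   sum_k z_k (S - j) (pi(d^k) - pi(d^n))_{i,j} and
   sum_k z_k j (pi(d^k) - pi(d^1))_{i,j}: these satisfy the Herzog-Kuehl
   equations of codimension c, and without mass elimination the pi(d^k) span all
   such diagrams supported on the positions of the chain. *)

Require Import Defs.
From mathcomp Require Import all_boot all_order all_algebra finmap.
From mathcomp Require Import ring zify.

Import Order.TTheory GRing.Theory Num.Theory.
Local Open Scope ring_scope.

(** * Degree sequences and the entries of pure diagrams *)

Lemma degree_sequenceP (m : nat) (d : seq int) :
  reflect (size d = m.+1 /\
           forall i j : nat, (i < j)%N -> (j <= m)%N -> d`_i < d`_j)
          (degree_sequence m d).
Proof.
rewrite /degree_sequence; apply: (iffP andP) => [[/eqP sd ltd]|[sd ltd]].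
  split=> // i j ij jm.
  by rewrite (@sorted_ltn_nth _ _ lt_trans 0) ?inE ?sd // ltnS (leq_trans _ jm) // ltnW.
split; first by rewrite sd.
(* Prepending a head smaller than every entry turns sortedness into a path, whose consecutive
   entries can all be compared by index. *)
apply: (@path_sorted _ _ (d`_0 - 1)).
by apply/(pathP 0) => -[|i] /=; rewrite sd ltnS => im;
  [case: d sd ltd {im} => // x d _ _ /=; rewrite ltrBlDr ltrDl|apply: ltd].
Qed.

Lemma pure_default (d : seq int) (x : position) :
  ~~ ((x.1 < size d)%N && (x.2 == d`_x.1)) -> pure d x = 0.
Proof.
move=> Hx; rewrite /pure fsfunE ifF //; apply/negP => /imfsetP[i /=].
rewrite mem_iota /= add0n => id xE; move: Hx; rewrite xE /= id eqxx; done.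
Qed.

Lemma pure_nth (d : seq int) (i : nat) : (i < size d)%N ->
  pure d (i, d`_i) =
  \prod_(0 <= k < size d | k != i) `|(d`_i - d`_k)%:~R|^-1.
Proof.
move=> id; rewrite /pure fsfunE ifT ?big_mkord //.
by apply/imfsetP; exists i => //=; rewrite mem_iota.
Qed.

Lemma degree_sequence_neq {m : nat} {d : seq int} (i k : nat) :
  degree_sequence m d -> (i <= m)%N -> (k <= m)%N -> k != i ->
  (d`_i - d`_k)%:~R != 0 :> rat.
Proof.
move=> /degree_sequenceP[_ ltd] im km; rewrite neq_lt intr_eq0 subr_eq0.
case/orP=> ki; first by rewrite gt_eqF ?ltd.
by rewrite lt_eqF ?ltd.
Qed.

Lemma pure_gt0 {m : nat} {d : seq int} (i : nat) :
  degree_sequence m d -> (i <= m)%N -> 0 < pure d (i, d`_i).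
Proof.
move=> dd im; have /degree_sequenceP[sd _] := dd.
rewrite pure_nth ?sd // big_seq_cond prodr_gt0 // => k.
rewrite mem_index_iota ltnS => /andP[km ki].
by rewrite invr_gt0 normr_gt0 (degree_sequence_neq _ _ dd).
Qed.

Lemma pure_ge0 {m : nat} {d : seq int} (x : position) :
  degree_sequence m d -> 0 <= pure d x.
Proof.
move=> dd; have /degree_sequenceP[sd _] := dd.
case: (boolP ((x.1 < size d)%N && (x.2 == d`_x.1))) => [|/pure_default-> //].
by case: x => i j /= /andP[+ /eqP->]; rewrite sd ltnS => im; rewrite ltW ?(pure_gt0 _ dd).
Qed.

Lemma pure_neq0 {m : nat} {d : seq int} (x : position) :
  degree_sequence m d ->
  (pure d x != 0) = (x.1 <= m)%N && (x.2 == d`_x.1).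
Proof.
move=> dd; have /degree_sequenceP[sd _] := dd.
apply/idP/idP => [|/andP[im /eqP xd]].
  by apply: contraNT => Hx; rewrite pure_default ?sd.
by case: x im xd => i j /= im ->; rewrite gt_eqF ?(pure_gt0 _ dd).
Qed.

Lemma sub_pureE (D : diagram) (z : rat) (d : seq int) (x : position) :
  sub_pure D z d x = D x - z * pure d x.
Proof.
rewrite /sub_pure fsfunE; case: ifPn => //.
rewrite in_fsetU negb_or => /andP[/fsfun_dflt-> /fsfun_dflt->].
by rewrite mulr0 subrr.
Qed.

(** * Positive chains of degree sequences and the greedy algorithm *)

Definition precedes (d d' : seq int) : bool :=
  all2 <=%R d d' && (d != d').

Lemma precedesP (m : nat) (d d' : seq int) :
  degree_sequence m d -> degree_sequence m d' ->
  reflect ((forall i : nat, (i <= m)%N -> d`_i <= d'`_i) /\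
           exists2 i : nat, (i <= m)%N & d`_i < d'`_i)
          (precedes d d').
Proof.
move=> /degree_sequenceP[sd _] /degree_sequenceP[sd' _].
have allP : reflect (forall i : nat, (i <= m)%N -> d`_i <= d'`_i)
                    (all2 <=%R d d').
  rewrite all2E sd sd' eqxx /=; apply: (iffP (all_nthP (0, 0))) => H i im.
    by have := H i; rewrite size_zip sd sd' minnn nth_zip ?sd ?sd' //=; apply.
  move: im; rewrite size_zip sd sd' minnn nth_zip ?sd ?sd' //=; apply: H.
rewrite /precedes; apply: (iffP andP) => -[/allP le_dd' ne_dd']; split=> //.
- case: (pickP (fun i : 'I_m.+1 => d`_i != d'`_i)) => [i ne|eq_dd'].
    by exists i; rewrite ?lt_neqAle ?ne ?le_dd' // -ltnS.
  case/eqP: ne_dd'; apply: (@eq_from_nth _ 0); rewrite ?sd' // sd => i im.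
  by apply/eqP; have /negbFE := eq_dd' (Ordinal im).
- by case: ne_dd' => i _; apply: contraTneq => ->; rewrite ltxx.
Qed.

Lemma precedes_trans : transitive precedes.
Proof.
move=> d2 d1 d3 /andP[le12 ne12] /andP[le23 ne23]; apply/andP; split.
  elim: d2 d1 d3 le12 le23 {ne12 ne23} => [|x d2 IH] [|y d1] [|u d3] //=.
  by move=> /andP[yx le12] /andP[xu /IH->] //; rewrite (le_trans yx xu).
apply: contraNneq ne12 => e13; move: le23; rewrite -e13 => le23 {d3 ne23 e13}.
apply/eqP; elim: d2 d1 le12 le23 => [|x d2 IH] [|y d1] //=.
move=> /andP[yx le12] /andP[xy le21]; congr (_ :: _); last exact: IH.
by apply/le_anti; rewrite yx.
Qed.

Definition combination (s : seq (rat * seq int)) (x : position) : rat :=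
  \sum_(u <- s) u.1 * pure u.2 x.

Definition positive_chain (m : nat) (s : seq (rat * seq int)) : bool :=
  [&& all (fun u => 0 < u.1) s, all (fun u => degree_sequence m u.2) s &
      sorted precedes (unzip2 s)].

Lemma positive_chain_behead (m : nat) u (s : seq (rat * seq int)) :
  positive_chain m (u :: s) -> positive_chain m s.
Proof.
case/and3P => /= /andP[_ zs] /andP[_ ds] /path_sorted ps.
exact/and3P.
Qed.

Lemma combination_ge0 (m : nat) (s : seq (rat * seq int)) (x : position) :
  positive_chain m s -> 0 <= combination s x.
Proof.
case/and3P => /allP z0 /allP dd _; rewrite /combination big_seq sumr_ge0 //.
by move=> u us; rewrite mulr_ge0 ?(pure_ge0 _ (dd u us)) ?ltW ?z0.
Qed.

Lemma combination_neq0 (m : nat) (s : seq (rat * seq int)) (x : position) :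
  positive_chain m s ->
  (combination s x != 0) = has (fun u => pure u.2 x != 0) s.
Proof.
elim: s => [|u s IH] cs; first by rewrite /combination big_nil eqxx.
have cs' := positive_chain_behead _ _ _ cs.
rewrite /= -IH // /combination big_cons -/(combination s x).
have /and3P[/= /andP[z0 _] /andP[dd _] _] := cs.
have := combination_ge0 _ _ x cs'; have := pure_ge0 x dd.
rewrite paddr_eq0 ?(combination_ge0 _ _ x cs') ?mulr_ge0 ?(pure_ge0 x dd) ?(ltW z0) //.
by rewrite mulf_eq0 (gt_eqF z0) negb_and.
Qed.

(* A position in the first degree sequence which disappears from the second
   one never comes back. *)
Lemma combination_next (m : nat) u v (s : seq (rat * seq int)) (i : nat) :
  positive_chain m [:: u, v & s] -> (i <= m)%N ->
  (combination (v :: s) (i, u.2`_i) != 0) = (u.2`_i == v.2`_i).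
Proof.
move=> cs im; have cs' := positive_chain_behead _ _ _ cs.
have /and3P[_ /= /and3P[du dv ds] /andP[uv vs]] := cs.
rewrite (combination_neq0 _ _ _ cs') /= (pure_neq0 _ dv) /= im /=.
case: eqP => //= /eqP ne; apply/hasPn => w ws; have dw := allP ds _ ws.
rewrite (pure_neq0 _ dw) /= im /= lt_eqF //.
have vw : precedes v.2 w.2.
  have /allP := order_path_min precedes_trans vs; apply; exact: map_f.
have [/(_ _ im) le1 _] := precedesP _ _ _ du dv uv.
have [/(_ _ im) le2 _] := precedesP _ _ _ dv dw vw.
by rewrite (lt_le_trans _ le2) // lt_neqAle ne.
Qed.

(** All coefficients are positive, so nothing cancels and the minimal degree in each column of the
    sum is that of the lowest sequence of the chain. Removing the first term leaves a shorter chain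
    of the same kind. *)
Lemma greedy_of_chain (m : nat) (D : diagram) (s : seq (rat * seq int)) :
  positive_chain m s -> D =1 combination s -> bs_decomposition m D s.
Proof.
elim: s D => [|[z d] s IH] D cs DE.
  by move=> x; rewrite DE /combination big_nil.
have cs' := positive_chain_behead _ _ _ cs.
have /and3P[/= /andP[z0 _] /andP[dd ds] ps] := cs.
have DE' : sub_pure D z d =1 combination s.
  by move=> x; rewrite sub_pureE DE /combination big_cons addrC addKr.
split; last exact: IH.
  split=> // i im; split=> [|j].
    by rewrite DE (combination_neq0 _ _ _ cs) /= (pure_neq0 _ dd) /= im eqxx.
  rewrite DE (combination_neq0 _ _ _ cs) => /hasP[u].
  rewrite inE => /predU1P[->|us] /=; first by rewrite (pure_neq0 _ dd) => /andP[_ /eqP/= ->].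
  have du := allP ds _ us; rewrite (pure_neq0 _ du) /= => /andP[_ /eqP->].
  have : precedes d u.2.
    have /allP := order_path_min precedes_trans ps; apply; exact: map_f.
  by case/(precedesP _ _ _ dd du) => /(_ _ im).
split=> // [x|q q0]; first by rewrite DE' (combination_ge0 m).
(* Maximality of the coefficient: at a position of [d] that the rest of the chain misses,
   subtracting [q] times [pure d] leaves [(z - q)] times a positive number, so nonnegativity forces
   [q <= z]. *)
have [i im D'0] : exists2 i, (i <= m)%N & combination s (i, d`_i) = 0.
  case: s {IH DE DE'} cs cs' ds ps => [|v s] cs cs' ds ps.
    by exists 0%N; rewrite // /combination big_nil.
  have /= /andP[dv _] := ds; have /= /andP[pdv _] := ps.
  have [_ [i im lti]] := precedesP _ _ _ dd dv pdv; exists i => //.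
  by apply/eqP/negbNE; rewrite (combination_next _ _ _ _ _ cs im) /= (lt_eqF lti).
have := q0 (i, d`_i); rewrite sub_pureE DE /combination big_cons -/(combination s _) D'0 /=.
by rewrite addr0 -mulrBl pmulr_lge0 ?subr_ge0 // (pure_gt0 _ dd).
Qed.

Lemma chain_of_greedy (m : nat) (D : diagram) (s : seq (rat * seq int)) :
  bs_decomposition m D s -> positive_chain m s /\ D =1 combination s.
Proof.
elim: s D => [|[z d] s IH] D.
  by move=> D0; split=> // x; rewrite D0 /combination big_nil.
move=> /= [[dd mind] [z0 _ maxz] run].
have [/and3P[zs ds ps] DE] := IH _ run; split; last first.
  by move=> x; rewrite /combination big_cons -/(combination s x) -DE sub_pureE /= addrC subrK.
rewrite /positive_chain /= z0 dd zs ds /=.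
case: s {IH} run zs ds ps DE => //= -[z' d'] s [[dd' mind'] [z'0 nn _] _].
move=> _ _ ps _; rewrite /= ps andbT.
have le_dd' i : (i <= m)%N -> d`_i <= d'`_i.
  move=> im; have [_ mini] := mind i im.
  have [+ _] := mind' i im; rewrite sub_pureE.
  case: (eqVneq (D (i, d'`_i)) 0) => [->|/mini //].
  rewrite sub0r oppr_eq0 mulf_eq0 (gt_eqF z0) /=.
  by rewrite (pure_neq0 _ dd) /= => /andP[_ /eqP->].
apply/(precedesP m) => //; split=> //.
(* If no column moved up, then [d' = d] and [z + z'] could have been subtracted in one step, against
   the maximality of [z]. *)
case: (pickP (fun i : 'I_m.+1 => d`_i < d'`_i)) => [i lti|ge_dd'].
  by exists i; rewrite // -ltnS.
have edd' : d' = d.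
  have /degree_sequenceP[sd _] := dd; have /degree_sequenceP[sd' _] := dd'.
  apply: (@eq_from_nth _ 0); rewrite ?sd' ?sd // => i im.
  have := ge_dd' (Ordinal im); rewrite /= lt_neqAle le_dd' // andbT.
  by move/negbFE/eqP.
have : z + z' <= z.
  apply: maxz => x; have := nn x; rewrite edd' !sub_pureE; congr (0 <= _).
  by rewrite mulrDl opprD addrA.
by rewrite gerDl leNgt z'0.
Qed.

(** * Elimination orders as departures along a chain *)

Definition departing {T : eqType} (x0 : T) (d d' : seq T) : seq (nat * T) :=
  [seq (i, nth x0 d i) | i <- iota 0 (size d) & nth x0 d i != nth x0 d' i].

Definition positions {T : Type} (x0 : T) (d : seq T) : seq (nat * T) :=
  [seq (i, nth x0 d i) | i <- iota 0 (size d)].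

(** The last sequence has no successor, and its step clears the whole diagram; hence all its
    positions are listed. Degrees live in an arbitrary [eqType] so that the construction also
    applies to symbolic degrees, which stand for j or j + t with t unspecified. *)
Fixpoint departures {T : eqType} (x0 : T) (L : seq (seq T)) : seq (seq (nat * T)) :=
  if L is d :: L' then
    (if L' is d' :: _ then departing x0 d d' else positions x0 d)
      :: departures x0 L'
  else [::].

Lemma mem_departing {T : eqType} (x0 : T) (d d' : seq T) (x : nat * T) :
  (x \in departing x0 d d') =
  [&& (x.1 < size d)%N, x.2 == nth x0 d x.1 & x.2 != nth x0 d' x.1].
Proof.
apply/mapP/and3P => [[i + ->]|[xd /eqP x2 ne]] /=.
  by rewrite mem_filter mem_iota add0n /= => /andP[ne ->].
exists x.1; last by case: x x2 {xd ne} => i j /= ->.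
by rewrite mem_filter mem_iota add0n /= xd -x2 ne.
Qed.

Lemma mem_positions {T : eqType} (x0 : T) (d : seq T) (x : nat * T) :
  (x \in positions x0 d) = (x.1 < size d)%N && (x.2 == nth x0 d x.1).
Proof.
apply/mapP/andP => [[i + ->]|[xd /eqP x2]] /=.
  by rewrite mem_iota add0n.
exists x.1; last by case: x x2 {xd} => i j /= ->.
by rewrite mem_iota add0n.
Qed.

Lemma uniq_departing {T : eqType} (x0 : T) (d d' : seq T) :
  uniq (departing x0 d d').
Proof. by rewrite map_inj_uniq ?filter_uniq ?iota_uniq // => i j []. Qed.

Lemma uniq_positions {T : eqType} (x0 : T) (d : seq T) : uniq (positions x0 d).
Proof. by rewrite map_inj_uniq ?iota_uniq // => i j []. Qed.

(** By positivity an entry vanishes exactly when no remaining sequence passes through its position,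
    and by [combination_next] a position that is left is left for good. So comparing neighbours in
    the chain is enough. *)
Lemma elimination_order_chain (m : nat) (D : diagram) (s : seq (rat * seq int)) :
  positive_chain m s -> D =1 combination s ->
  elimination_order D s = [seq [fset x in E]%fset | E <- departures 0 (unzip2 s)].
Proof.
elim: s D => [|[z d] s IH] D cs DE //=.
have cs' := positive_chain_behead _ _ _ cs.
have /and3P[/= /andP[z0 _] /andP[dd ds] ps] := cs.
have /degree_sequenceP[sd _] := dd.
have DE' : sub_pure D z d =1 combination s.
  by move=> x; rewrite sub_pureE DE /combination big_cons addrC addKr.
congr (_ :: _); last exact: IH.
apply/fsetP => x; rewrite !inE /= mem_finsupp DE DE'.
case: (eqVneq (combination s x) 0) => [cx0|cxn]; last first.
  rewrite andbF; apply/esym/negbTE; move: cxn.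
  case: s {IH DE DE'} cs cs' ds ps => [|v s] cs _ ds ps.
    by rewrite /combination big_nil eqxx.
  apply: contra; rewrite /= mem_departing sd ltnS => /and3P[im /eqP x2 ne].
  case: x im x2 ne => i j /= im -> ne.
  by apply/negPn; rewrite (combination_next _ _ _ _ _ cs im) /= (negbTE ne).
rewrite andbT /combination big_cons -/(combination s x) cx0 addr0 /=.
rewrite mulf_eq0 (gt_eqF z0) (pure_neq0 _ dd) /=.
case: s {IH DE DE'} cs cs' ds ps cx0 => [|v s] cs _ ds ps cx0 /=.
  by rewrite mem_positions sd ltnS.
rewrite mem_departing sd ltnS; case: x cx0 => i j /=.
case: leqP => //= im; case: eqP => //= -> cx0.
by have := combination_next _ _ _ _ _ cs im; rewrite cx0 eqxx /= => <-.
Qed.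

(** * Herzog-Kuehl equations and the span of pure diagrams *)

(* Its vanishing for all [g] of size at most [m] is the system of Herzog-Kuehl
   equations in codimension m. *)
Definition moment (X : seq position) (F : position -> rat) (g : {poly rat}) : rat :=
  \sum_(x <- X) (-1) ^+ x.1 * F x * g.[x.2%:~R].

Lemma moment_support (X Y : seq position) (F : position -> rat) (g : {poly rat}) :
  uniq X -> uniq Y -> {subset Y <= X} -> (forall x, x \notin Y -> F x = 0) ->
  moment X F g = moment Y F g.
Proof.
move=> uX uY YX F0; rewrite /moment (bigID (mem Y)) /=.
rewrite [X in _ + X]big1 => [|x /F0->]; last by rewrite mulr0 mul0r.
rewrite addr0 -big_filter; apply: perm_big; apply: uniq_perm; rewrite ?filter_uniq //.
by move=> x; rewrite mem_filter andb_idr // => /YX.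
Qed.

Lemma moment_sum (X : seq position) (n : nat) (y : 'I_n -> rat)
    (F : 'I_n -> position -> rat) (g : {poly rat}) :
  moment X (fun x => \sum_(k < n) y k * F k x) g =
  \sum_(k < n) y k * moment X (F k) g.
Proof.
rewrite /moment; under eq_bigr do rewrite mulr_sumr mulr_suml.
rewrite exchange_big; apply: eq_bigr => k _; rewrite mulr_sumr.
by apply: eq_bigr => x _; ring.
Qed.

Lemma momentB (X : seq position) (F G : position -> rat) (g : {poly rat}) :
  moment X (fun x => F x - G x) g = moment X F g - moment X G g.
Proof. by rewrite /moment -sumrB; apply: eq_bigr => x _; ring. Qed.

Lemma momentZ (X : seq position) (a : rat) (F : position -> rat) (g : {poly rat}) :
  moment X (fun x => a * F x) g = a * moment X F g.
Proof. by rewrite /moment mulr_sumr; apply: eq_bigr => x _; ring. Qed.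

Lemma eq_moment (X : seq position) (F G : position -> rat) (g : {poly rat}) :
  F =1 G -> moment X F g = moment X G g.
Proof. by move=> FG; apply: eq_bigr => x _; rewrite FG. Qed.

Lemma moment_mul (X : seq position) (F : position -> rat) (h g : {poly rat}) :
  moment X (fun x => F x * h.[x.2%:~R]) g = moment X F (h * g).
Proof. by apply: eq_bigr => x _; rewrite hornerM; ring. Qed.

(** Lagrange interpolation at m + 1 nodes reproduces [g]; each [L i] is monic of degree m, so
    comparing coefficients of degree m gives the formula. *)
Lemma divided_difference (K : fieldType) (m : nat) (u : nat -> K) (g : {poly K}) :
  (forall i k, (i <= m)%N -> (k <= m)%N -> u i = u k -> i = k) ->
  (size g <= m.+1)%N ->
  \sum_(0 <= i < m.+1)
    g.[u i] * \prod_(0 <= k < m.+1 | k != i) (u i - u k)^-1 = g`_m.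
Proof.
move=> inju szg.
pose s i := [seq k <- iota 0 m.+1 | k != i].
pose L i := \prod_(k <- s i) ('X - (u k)%:P).
have sL i : (i <= m)%N -> size (L i) = m.+1.
  move=> im; rewrite size_prod_XsubC /s size_filter; congr _.+1.
  have := count_predC (pred1 i) (iota 0 m.+1).
  rewrite count_uniq_mem ?iota_uniq // mem_iota leq0n add0n ltnS im size_iota => /eqP.
  by rewrite add1n eqSS => /eqP.
have Lu i k : (i <= m)%N -> (k <= m)%N -> k != i -> (L i).[u k] = 0.
  move=> im km ki; rewrite /L (big_rem k) /=; last by rewrite mem_filter mem_iota ki.
  by rewrite hornerM hornerXsubC subrr mul0r.
have Lii i : (L i).[u i] = \prod_(0 <= k < m.+1 | k != i) (u i - u k).
  by rewrite /L /s big_filter horner_prod; apply: eq_bigr => k _; rewrite hornerXsubC.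
pose w i := g.[u i] * \prod_(0 <= k < m.+1 | k != i) (u i - u k)^-1.
pose P := \sum_(0 <= i < m.+1) w i *: L i.
suff eP : P = g.
  rewrite -[in RHS]eP /P coef_sum big_seq [RHS]big_seq; apply: eq_bigr => i.
  rewrite mem_index_iota /= ltnS => im; rewrite coefZ.
  have := monicP (monic_prod_XsubC (s i) xpredT u).
  by rewrite /lead_coef -/(L i) sL //= => ->; rewrite mulr1.
apply/eqP; rewrite -subr_eq0; apply/eqP.
apply: (@roots_geq_poly_eq0 _ _ [seq u k | k <- iota 0 m.+1]).
- apply/allP => _ /mapP[k + ->]; rewrite mem_iota add0n ltnS /= => km.
  rewrite /root hornerD hornerN horner_sum subr_eq0; apply/eqP.
  rewrite (bigD1_seq k) ?mem_index_iota ?iota_uniq //= big_seq_cond big1.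
    rewrite hornerZ Lii /w addr0 -mulrA -big_split /= big1_seq ?mulr1 // => j.
    rewrite mem_index_iota ltnS => /andP[jk /andP[_ jm]]; rewrite mulVf // subr_eq0.
    by apply: contraNneq jk => /inju->.
  move=> i; rewrite mem_index_iota ltnS => /andP[im ik].
  by rewrite hornerZ Lu ?mulr0 // eq_sym.
- rewrite map_inj_in_uniq ?iota_uniq // => i k.
  by rewrite !mem_iota !add0n !ltnS /=; apply: inju.
rewrite size_map size_iota (leq_trans (size_polyD _ _)) // geq_max size_polyN szg andbT.
apply: (leq_trans (size_sum _ _ _)); apply/bigmax_leqP_seq => i.
rewrite mem_index_iota ltnS /= => im _.
by rewrite (leq_trans (size_scale_leq _ _)) // sL.
Qed.

(** With alternating signs, the entries of a pure diagram are, up to a global sign, the weights of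
    the divided difference at its degrees. The value depends on [g] and m only, not on [d], so the
    difference of two pure diagrams satisfies one more equation than each of them. *)
Lemma moment_pure {m : nat} {d : seq int} (X : seq position) (g : {poly rat}) :
  degree_sequence m d -> uniq X -> {subset positions 0 d <= X} ->
  (size g <= m.+1)%N -> moment X (pure d) g = (-1) ^+ m * g`_m.
Proof.
move=> dd uX dX szg; have /degree_sequenceP[sd ltd] := dd.
rewrite (moment_support _ _ _ _ uX (uniq_positions 0 d) dX); last first.
  by move=> x; rewrite mem_positions => /pure_default.
rewrite -(divided_difference _ m (fun i => (d`_i)%:~R) g) //; last first.
  move=> i k im km; case: (eqVneq k i) => // ki /eqP.
  by rewrite -subr_eq0 -intrB (negbTE (degree_sequence_neq _ _ dd im km ki)).
rewrite /moment big_map sd -[iota 0 _]/(index_iota 0 m.+1) mulr_sumr.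
rewrite big_seq [RHS]big_seq; apply: eq_bigr => i; rewrite mem_index_iota ltnS /= => im.
rewrite pure_nth ?sd //.
have E : \prod_(0 <= k < m.+1 | k != i) `|(d`_i - d`_k)%:~R|^-1 =
  \prod_(0 <= k < m.+1 | k != i) ((-1) ^+ (i < k)%N * ((d`_i)%:~R - (d`_k)%:~R)^-1) :> rat.
  rewrite big_seq_cond [RHS]big_seq_cond; apply: eq_bigr => k.
  rewrite mem_index_iota ltnS /= => /andP[km]; rewrite neq_ltn => /orP[ki|ik].
    by rewrite ltnNge (ltnW ki) mul1r intrB gtr0_norm ?subr_gt0 ?ltr_int ?ltd.
  by rewrite ik mulN1r intrB ltr0_norm ?subr_lt0 ?ltr_int ?ltd // invrN.
rewrite E big_split prodrXr /=.
(* The differences d_i - d_k are negative exactly for k > i, which gives m - i signs; together with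
   the sign of column i they make the global sign of exponent m. *)
have -> : (\sum_(0 <= k < m.+1 | k != i) (i < k) = m - i)%N.
  rewrite big_mkcond (big_cat_nat_idem _ (leq0n i.+1)) //=.
  rewrite big_nat big1 => [|k /andP[_]]; last first.
    by rewrite ltnS leqNgt; case: (i < k)%N => // _; case: ifP.
  rewrite add0n big_nat (eq_bigr (fun=> 1%N)) => [|k /andP[ik _]].
    by rewrite -big_nat sum_nat_const_nat muln1 subSS.
  by rewrite ik; case: eqP ik => // ->; rewrite ltnn.
rewrite !mulrA -exprD subnKC // -!mulrA; congr (_ * _); exact: mulrC.
Qed.

Lemma moment_pure0 {m : nat} {d : seq int} (X : seq position) (g : {poly rat}) :
  degree_sequence m d -> uniq X -> {subset positions 0 d <= X} ->
  (size g <= m)%N -> moment X (pure d) g = 0.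
Proof.
move=> dd uX dX szg; rewrite (moment_pure _ _ dd) // ?(leq_trans szg) //.
by rewrite nth_default ?mulr0.
Qed.

Definition steps_simple : rel (seq int) :=
  fun d d' => (size (departing (0 : int) d d') <= 1)%N.

(* On a chain in which each step replaces a single position, the positions left
   behind one after the other give a triangular system; the last m + 1
   positions carry only multiples of one pure diagram. *)
Lemma pure_span (m : nat) (ds : seq (seq int)) (X : seq position)
    (F : position -> rat) :
  all (degree_sequence m) ds -> sorted precedes ds -> sorted steps_simple ds ->
  ds != [::] -> uniq X ->
  (forall d, d \in ds -> {subset positions (0 : int) d <= X}) ->
  (forall x, F x != 0 -> has (fun d => x \in positions (0 : int) d) ds) ->
  (forall g : {poly rat}, (size g <= m)%N -> moment X F g = 0) ->
  exists y : seq rat,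
    forall x, F x = \sum_(k < size ds) y`_k * pure (nth [::] ds k) x.
Proof.
move=> + + + + uX; elim: ds F => // d ds IH F /= /andP[dd dds] pd sd _ dX F0 mF.
have /degree_sequenceP[szd ltd] := dd.
have dXd : {subset positions (0 : int) d <= X} by apply: dX; rewrite mem_head.
pose G (y : rat) (x : position) : rat := F x - y * pure d x.
have mG y (g : {poly rat}) : (size g <= m)%N -> moment X (G y) g = 0.
  by move=> szg; rewrite momentB momentZ (moment_pure0 _ _ dd) // mF // mulr0 subrr.
case: ds IH dds pd sd dX F0 => [|d' ds] IH dds pd sd dX F0.
  pose y := F (m, d`_m) / pure d (m, d`_m).
  exists [:: y] => x; rewrite big_ord1 /=; apply/eqP; rewrite -subr_eq0 -/(G y x).
  have Gsupp z : z \notin positions (0 : int) d -> G y z = 0.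
    move=> zd; rewrite /G pure_default -?(mem_positions (0 : int) d) // mulr0 subr0.
    by apply/eqP; apply: contraNT zd => /F0; rewrite /= orbF.
  have Gm : G y (m, d`_m) = 0.
    by rewrite /G /y mulfVK ?subrr // gt_eqF ?(pure_gt0 _ dd).
  case: (boolP (x \in positions (0 : int) d)) => [|/Gsupp->//].
  rewrite mem_positions szd ltnS => /andP[im /eqP xd].
  case: x im xd => i j /= im ->{j}.
  move: im; rewrite leq_eqVlt => /predU1P[->|im]; first by rewrite Gm.
  (* The test polynomial vanishes at all degrees of [d] except those of columns i and m, and [G y]
     already vanishes in column m. The equation therefore isolates the entry in column i, and the
     degree m - 1 of the polynomial is just within the allowed range. *)
  pose s := [seq k <- iota 0 m | k != i].
  pose g : {poly rat} := \prod_(k <- s) ('X - ((d`_k)%:~R)%:P).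
  have szg : size g = m.
    rewrite size_prod_XsubC /s size_filter.
    have := count_predC (pred1 i) (iota 0 m).
    by rewrite count_uniq_mem ?iota_uniq // mem_iota leq0n add0n im size_iota add1n.
  have := mG y g; rewrite szg leqnn => /(_ isT).
  rewrite (moment_support _ _ _ _ uX (uniq_positions (0 : int) d) dXd Gsupp).
  rewrite /moment big_map szd (bigD1_seq i) ?iota_uniq ?mem_iota ?ltnS ?(ltnW im) //=.
  rewrite -/(iota 0 m.+1) [X in _ + X]big1_seq ?addr0 => [/eqP|k].
    rewrite !mulf_eq0 signr_eq0 /= => /orP[//|].
    rewrite /g horner_prod prodf_seq_eq0 => /hasP[k].
    rewrite mem_filter mem_iota add0n => /andP[ki km] /=.
    have := degree_sequence_neq _ _ dd (ltnW im) (ltnW km) ki.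
    by rewrite hornerXsubC -intrB => /negbTE->.
  rewrite mem_iota add0n ltnS => /andP[ki]; rewrite leq0n /=.
  rewrite leq_eqVlt => /predU1P[->|km]; first by rewrite Gm mulr0 mul0r.
  rewrite /g (big_rem k) /= ?mem_filter ?ki ?mem_iota //.
  by rewrite hornerM hornerXsubC subrr mul0r mulr0.
have /andP[dd' _] := dds.
have /= /andP[pdd' pds] := pd; have /= /andP[sdd' sds] := sd.
have [le_dd' [i im lti]] := precedesP _ _ _ dd dd' pdd'.
have other k : (k <= m)%N -> k != i -> d`_k = d'`_k.
  move=> km ki; apply/eqP; move: sdd'; apply: contraTT => ne.
  rewrite -ltnNge; apply: (@uniq_leq_size _ [:: (i, d`_i); (k, d`_k)]) => [|x].
    by rewrite /= inE xpair_eqE eq_sym (negbTE ki).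
  rewrite !inE => /orP[]/eqP->; rewrite mem_departing szd ltnS eqxx /= ?im ?km //=.
  by rewrite (lt_eqF lti).
(* The first coefficient is forced by the single position that [d] does not share with [d']. Once
   this entry is cleared, the support lies on the positions of the remaining chain. *)
pose y := F (i, d`_i) / pure d (i, d`_i).
have Gi : G y (i, d`_i) = 0.
  by rewrite /G /y mulfVK ?subrr // gt_eqF ?(pure_gt0 _ dd).
case: (IH (G y) dds pds sds isT) => [e eds|x|g szg|ys Gys].
- by apply: dX; rewrite inE eds orbT.
- move=> Gx0; have : x \in positions (0 : int) d \/ has (fun d => x \in positions (0 : int) d) (d' :: ds).
    move: Gx0; rewrite /G; case: (eqVneq (pure d x) 0) => [->|].
      by rewrite mulr0 subr0 => /F0 /orP.
    by rewrite (pure_neq0 _ dd) mem_positions szd ltnS => ->; left.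
  case=> //; rewrite mem_positions szd ltnS => /andP[xm xd].
  rewrite /= mem_positions; have /degree_sequenceP[-> _] := dd'.
  rewrite ltnS xm /= -other ?xd //; apply: contraNneq Gx0 => xi.
  by case: x xi xd {xm} => k j /= -> /eqP->; rewrite Gi.
- exact: mG.
exists (y :: ys) => x; rewrite big_ord_recl /= -Gys /G addrC subrK //.
Qed.

(** Outside column r the two diagrams differ only in the factor coming from the degree in column r.
    Multiplying by that degree minus x.2 reduces the factor to a sign, which depends only on whether
    r lies left of the column considered. In column r both sides are 0. *)
Lemma exchange_degree (m r : nat) (e e' : seq int) (x : position) :
  degree_sequence m e -> degree_sequence m e' -> (r <= m)%N ->
  (forall k, (k <= m)%N -> k != r -> e`_k = e'`_k) ->
  pure e x * (e`_r - x.2)%:~R = pure e' x * (e'`_r - x.2)%:~R.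
Proof.
move=> de de' rm ee'.
have /degree_sequenceP[sze lte] := de; have /degree_sequenceP[sze' lte'] := de'.
case: x => i j /=.
case: (leqP i m) => im; last first.
  by rewrite !pure_default ?mul0r // ?sze ?sze' ltnS leqNgt im.
have [{i im}->|ir] := eqVneq i r.
  have H f k : degree_sequence m f -> pure f (r, k) * (f`_r - k)%:~R = 0.
    move=> df; apply/eqP; rewrite mulf_eq0; apply/orP.
    case: (eqVneq (pure f (r, k)) 0) => [|]; first by left.
    by rewrite (pure_neq0 _ df) /= => /andP[_ /eqP->]; right; rewrite subrr.
  by rewrite !H.
have [->|ne] := eqVneq j e`_i; last first.
  by rewrite !pure_default ?mul0r //= -?ee' // (negbTE ne) andbF.
rewrite {2}(ee' i) // [in RHS](ee' i) // !pure_nth ?sze ?sze' //.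
have rn : (r < m.+1)%N by [].
rewrite -(ee' i) // !big_mkord !(bigD1 (Ordinal rn) (P := fun k => _ k != _)) /= 1?eq_sym //.
have -> : \prod_(k < m.+1 | (k != i :> nat) && (k != Ordinal rn)) `|(e`_i - e'`_k)%:~R|^-1 =
  \prod_(k < m.+1 | (k != i :> nat) && (k != Ordinal rn)) `|(e`_i - e`_k)%:~R|^-1 :> rat.
  by apply: eq_bigr => k /andP[_ kr]; have km := ltn_ord k; rewrite (ee' k km kr).
have H f : degree_sequence m f -> f`_i = e`_i ->
    `|(e`_i - f`_r)%:~R|^-1 * (f`_r - e`_i)%:~R = (-1) ^+ (r < i)%N :> rat.
  move=> df fi; have /degree_sequenceP[_ ltf] := df; rewrite -fi.
  have n0 : (f`_r - f`_i)%:~R != 0 :> rat by rewrite (degree_sequence_neq _ _ df).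
  rewrite -normrN -intrN opprB.
  move: ir n0; rewrite neq_ltn => /orP[lir|lri] n0.
    by rewrite ltnNge (ltnW lir) gtr0_norm ?mulVf // ltr0z subr_gt0 ltf.
  by rewrite lri ltr0_norm ?ltrz0 ?subr_lt0 ?ltf // invrN mulNr mulVf.
rewrite mulrAC (H e) // mulrAC (H e') // -ee' //.
Qed.

(** The difference of two pure diagrams has vanishing moments against all polynomials of degree at
    most m, since their moments agree there. Multiplying by [h], of degree at most 1, costs one
    degree and leaves the Herzog-Kuehl equations of codimension m, so [pure_span] applies. *)
Lemma span_correction (m : nat) (ds : seq (seq int)) (z : nat -> rat)
    (h : {poly rat}) (l : nat) :
  all (degree_sequence m) ds -> sorted precedes ds -> sorted steps_simple ds ->
  (l < size ds)%N -> (size h <= 2)%N ->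
  exists y : seq rat, forall x,
    \sum_(k < size ds) z k *
      ((pure (nth [::] ds k) x - pure (nth [::] ds l) x) * h.[x.2%:~R]) =
    \sum_(k < size ds) y`_k * pure (nth [::] ds k) x.
Proof.
move=> dds pds sds lds szh.
pose X : seq position := undup (flatten [seq positions (0 : int) d | d <- ds]).
have dX d : d \in ds -> {subset positions (0 : int) d <= X}.
  move=> d_ds x xd; rewrite mem_undup; apply/flattenP.
  by exists (positions 0 d) => //; apply: map_f.
apply: (pure_span m ds X) => //; first by rewrite -size_eq0 -lt0n (leq_trans _ lds).
- exact: undup_uniq.
- move=> x; apply: contraNT => /hasPn nx; apply/eqP; apply: big1 => k _.
  have P0 j : (j < size ds)%N -> pure (nth [::] ds j) x = 0.
    move=> jn; apply/pure_default; rewrite -(mem_positions (0 : int)).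
    by apply: nx; apply: mem_nth.
  by rewrite !P0 // subrr mul0r mulr0.
move=> g szg; rewrite moment_sum big1 // => k _.
rewrite moment_mul momentB.
have Pg j : (j < size ds)%N -> moment X (pure (nth [::] ds j)) (h * g) = (-1) ^+ m * (h * g)`_m.
  move=> jn; have jds := mem_nth [::] jn.
  apply: moment_pure; [exact: (allP dds) | exact: undup_uniq | exact: dX |].
  rewrite (leq_trans (size_polyMleq _ _)) //; lia.
by rewrite !Pg // subrr mulr0.
Qed.

(* Off [p] one may divide the hypothesis by [h + t]; the vanishing of the moment
   of the constant 1 then gives the identity at [p] as well. *)
Lemma lift_combination (m n l : nat) (z y : nat -> rat) (D : nat -> seq int)
    (p : position) (h : {poly rat}) (t : rat) :
  (0 < m)%N -> (l < n)%N -> (size h <= 2)%N ->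
  (forall k, (k < n)%N -> degree_sequence m.+1 (D k)) ->
  p \in positions (0 : int) (D l) ->
  (forall k (x : position), (k < n)%N -> pure (D k) x != 0 -> h.[x.2%:~R] + t = 0 -> x = p) ->
  (forall x : position,
     \sum_(k < n) z k *
       ((pure (D k) x * (h.[x.2%:~R] + t) - pure (D l) x * (h.[x.2%:~R] + t)) *
        h.[x.2%:~R]) =
     \sum_(k < n) y k * (pure (D k) x * (h.[x.2%:~R] + t))) ->
  forall x : position,
    \sum_(k < n) z k * (pure (D k) x * (h.[x.2%:~R] + t)) =
    \sum_(k < n) (z k * t + y k) * pure (D k) x
      + (\sum_(k < n) z k) * (pure (D l) x * h.[x.2%:~R]).
Proof.
move=> m0 ln szh dD pl zero span.
pose L (x : position) : rat := \sum_(k < n) z k * (pure (D k) x * (h.[x.2%:~R] + t)).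
pose R (x : position) : rat := \sum_(k < n) (z k * t + y k) * pure (D k) x
      + (\sum_(k < n) z k) * (pure (D l) x * h.[x.2%:~R]).
have off (x : position) : x != p -> L x = R x.
  move=> xp; case: (eqVneq (h.[x.2%:~R] + t) 0) => [v0|v0].
    have P0 k : (k < n)%N -> pure (D k) x = 0.
      by move=> kn; apply/eqP; apply: contraNT xp => Pk; rewrite (zero k x kn Pk v0).
    rewrite /L /R (P0 l) // mul0r mulr0 addr0.
    by apply: eq_bigr => k _; rewrite P0 // mul0r !mulr0.
  apply: (mulIf v0); rewrite /R mulrDl.
  transitivity (\sum_(k < n) z k * t * pure (D k) x * (h.[x.2%:~R] + t)
    + \sum_(k < n) y k * (pure (D k) x * (h.[x.2%:~R] + t))
    + (\sum_(k < n) z k) * (pure (D l) x * h.[x.2%:~R]) * (h.[x.2%:~R] + t)); last first.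
    congr (_ + _); rewrite -big_split mulr_suml /=; apply: eq_bigr => k _; ring.
  rewrite -span /L !mulr_suml -!big_split /=; apply: eq_bigr => k _; ring.
move=> x; rewrite -/(L x) -/(R x); case: (eqVneq x p) => [->{x}|/off //].
pose X : seq position :=
  undup (flatten [seq positions (0 : int) (D k) | k <- iota 0 n]).
have uX : uniq X := undup_uniq _.
have dX k : (k < n)%N -> {subset positions (0 : int) (D k) <= X}.
  move=> kn x xd; rewrite mem_undup; apply/flattenP.
  by exists (positions (0 : int) (D k)) => //; apply/mapP; exists k; rewrite ?mem_iota.
(* The sequences [D k] have codimension m + 1, at least 2 because m is positive, so their moments
   vanish against every polynomial of degree at most 1, in particular against [h] and [h + t]. *)
have mP k (g : {poly rat}) : (k < n)%N -> (size g <= 2)%N -> moment X (pure (D k)) g = 0.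
  move=> kn szg; apply: (moment_pure0 _ _ (dD k kn)) => //; first exact: dX.
  by rewrite (leq_trans szg).
have sz1 : (size (1%R : {poly rat}) <= 2)%N by rewrite size_poly1.
have : moment X (fun x : position => L x - R x) 1 = 0.
  rewrite momentB /L moment_sum big1 => [|k _]; last first.
    have -> : moment X (fun x : position => pure (D k) x * (h.[x.2%:~R] + t)) 1 =
              moment X (pure (D k)) ((h + t%:P) * 1).
      by rewrite -moment_mul; apply: eq_moment => u; rewrite hornerD hornerC.
    rewrite mulr1 mP ?mulr0 // (leq_trans (size_polyD _ _)) // geq_max szh.
    by rewrite (leq_trans (size_polyC_leq1 _)).
  have -> : moment X R 1 =
    moment X (fun x : position => \sum_(k < n) (z k * t + y k) * pure (D k) x) 1 -
    moment X (fun x : position => - (\sum_(k < n) z k) * (pure (D l) x * h.[x.2%:~R])) 1.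
    by rewrite -momentB; apply: eq_moment => u; rewrite /R mulNr opprK.
  rewrite moment_sum big1 => [|k _]; last by rewrite mP ?mulr0.
  by rewrite momentZ moment_mul mulr1 mP // mulr0 !subr0.
rewrite (moment_support _ [:: p] _ _ uX) //.
- rewrite /moment big_seq1 hornerC mulr1 => /eqP.
  by rewrite mulf_eq0 signr_eq0 /= subr_eq0 => /eqP.
- by move=> u; rewrite inE => /eqP->; apply: dX pl.
- by move=> u; rewrite inE => /off->; rewrite subrr.
Qed.

(** * Pure diagrams in codimension m + 1: appended, raised and bridging sequences *)

Lemma degree_sequence_rcons (m : nat) (d : seq int) (e : int) :
  degree_sequence m d -> d`_m < e -> degree_sequence m.+1 (rcons d e).
Proof.
move=> /degree_sequenceP[sd ltd] de; apply/degree_sequenceP.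
split=> [|i j ij jm]; first by rewrite size_rcons sd.
rewrite !nth_rcons sd; move: jm; rewrite leq_eqVlt => /predU1P[ej|jm].
  rewrite {1}ej ltnn ej eqxx -ej ij; move: ij; rewrite ej ltnS leq_eqVlt.
  by case/predU1P=> [->//|im]; rewrite (lt_trans _ de) ?ltd.
by rewrite jm (ltn_trans ij jm) ltd.
Qed.

(** The appended degree contributes the factor 1 / (e - d_i) in column i, which is multiplied away;
    at the new position the multiplier e - j is 0. *)
Lemma pure_rcons (m : nat) (d : seq int) (e : int) (x : position) :
  degree_sequence m d -> d`_m < e ->
  pure d x = pure (rcons d e) x * (e - x.2)%:~R.
Proof.
move=> dd de; have /degree_sequenceP[sd ltd] := dd.
case: x => i j /=; case: (ltnP i m.+1) => im; last first.
  rewrite [LHS]pure_default; last by rewrite /= sd ltnNge im.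
  case: (eqVneq j e) => [->|je]; first by rewrite subrr mulr0.
  rewrite pure_default ?mul0r // size_rcons sd /= nth_rcons sd [(i < m.+1)%N]ltnNge im /=.
  have [->|ne] := eqVneq i m.+1; first by rewrite (negbTE je) andbF.
  by rewrite ltnS leq_eqVlt (negbTE ne) ltnNge im.
have [->|ne] := eqVneq j d`_i; last first.
  by rewrite !pure_default ?mul0r //= ?nth_rcons ?sd ?im (negbTE ne) andbF.
have Ei : (rcons d e)`_i = d`_i by rewrite nth_rcons sd im.
rewrite -{2}Ei !pure_nth ?size_rcons ?sd // 1?ltnW // Ei.
rewrite [in RHS]big_mkcond big_nat_recr //= gtn_eqF //.
rewrite nth_rcons sd ltnn eqxx -big_mkcond /= -mulrA.
have lt_ie : d`_i < e.
  by move: im; rewrite ltnS leq_eqVlt => /predU1P[->//|im]; rewrite (lt_trans _ de) ?ltd.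
rewrite -normrN -intrN opprB gtr0_norm ?ltr0z ?subr_gt0 //.
rewrite mulVf ?gt_eqF ?ltr0z ?subr_gt0 // mulr1 big_nat_cond [RHS]big_nat_cond.
by apply: eq_bigr => k /andP[/andP[_ km] _]; rewrite nth_rcons sd km.
Qed.

Definition raise (t : int) (d : seq int) : seq int := 0 :: [seq j + t | j <- d].

Lemma nth_raise (t : int) (d : seq int) (i : nat) :
  (i < size d)%N -> (raise t d)`_i.+1 = d`_i + t.
Proof. by move=> id; rewrite /= (nth_map 0). Qed.

Lemma degree_sequence_raise (m : nat) (d : seq int) (t : int) :
  degree_sequence m d -> 0 < d`_0 + t -> degree_sequence m.+1 (raise t d).
Proof.
move=> /degree_sequenceP[sd ltd] t0; apply/degree_sequenceP.
split=> [|[|i] [|j] //= ij jm]; first by rewrite /= size_map sd.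
  rewrite (nth_map 0) ?sd //; case: j {ij} jm => // j jm.
  by rewrite (lt_trans t0) // ltrD2r ltd.
have im : (i < m.+1)%N by apply: ltn_trans jm.
by rewrite !(nth_map 0) ?sd // ltrD2r ltd.
Qed.

(** Translation by t preserves all differences of degrees, and the new degree 0 contributes the
    factor 1 / j. *)
Lemma pure_raise (m : nat) (d : seq int) (t : int) (i : nat) (j : int) :
  degree_sequence m d -> 0 < d`_0 + t ->
  pure d (i, j - t) = pure (raise t d) (i.+1, j) * j%:~R.
Proof.
move=> dd t0; have /degree_sequenceP[sd ltd] := dd.
case: (ltnP i m.+1) => im; last first.
  by rewrite !pure_default ?mul0r //= ?size_map sd ltnNge ?ltnS im.
have [->|ne] := eqVneq j (d`_i + t); last first.
  rewrite !pure_default ?mul0r //= ?(nth_map 0) ?sd // ?(negbTE ne) ?andbF //.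
  by rewrite subr_eq (negbTE ne) andbF.
rewrite addrK -{1}nth_raise ?sd // !pure_nth /= ?size_map ?sd //.
rewrite (nth_map 0) ?sd // [in RHS]big_mkcond big_nat_recl //= subr0.
have gt0 : 0 < d`_i + t.
  by case: i im {ltd} (ltd 0%N i) => // i im lt0; rewrite (lt_trans t0) // ltrD2r lt0.
rewrite gtr0_norm ?ltr0z // mulrAC mulVf ?gt_eqF ?ltr0z // mul1r -big_mkcond.
rewrite /= big_nat_cond [RHS]big_nat_cond; apply: eq_bigr => k /andP[/andP[_ km] _].
by rewrite (nth_map 0) ?sd // opprD addrACA subrr addr0.
Qed.

Definition shift (t : int) (F : position -> rat) (x : position) : rat :=
  if x.1 is i.+1 then F (i, x.2 - t) else 0.

Lemma shift_pure (m : nat) (d : seq int) (t : int) (x : position) :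
  degree_sequence m d -> 0 < d`_0 + t ->
  shift t (pure d) x = pure (raise t d) x * x.2%:~R.
Proof.
case: x => -[|i] j dd t0; rewrite /shift /=; last exact: (pure_raise m).
apply/esym/eqP; rewrite mulf_eq0; apply/orP.
case: (eqVneq j 0) => [->|j0]; [by right | left].
by rewrite pure_default //= (negbTE j0) andbF.
Qed.

(** [lift_combination] with h = S - j: the factor h + t = S + t - j turns each appended sequence
    back into the original one, and vanishes only at the common last position (m + 1, S + t). The
    correction [y] comes from the original chain and is chosen before [t], which is what makes the
    coefficients linear in t. The last summand is the error to be absorbed by the bridges. *)
Lemma lift_low (m : nat) (ds : seq (seq int)) (z : nat -> rat) (S : int) :
  (0 < m)%N ->
  all (degree_sequence m) ds -> sorted precedes ds -> sorted steps_simple ds ->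
  ds != [::] -> (forall d, d \in ds -> d`_m = S) ->
  exists y : seq rat, forall (t : int) (x : position), 0 < t ->
    \sum_(k < size ds) z k * pure (nth [::] ds k) x =
    \sum_(k < size ds)
      (z k * t%:~R + y`_k) * pure (rcons (nth [::] ds k) (S + t)) x
    + (\sum_(k < size ds) z k) *
      (pure (rcons (last [::] ds) (S + t)) x * (S - x.2)%:~R).
Proof.
move=> m0 dds pds sds ds0 dS.
have n0 : (0 < size ds)%N by rewrite lt0n size_eq0.
have ln : ((size ds).-1 < size ds)%N by rewrite prednK.
pose h : {poly rat} := (S%:~R)%:P - 'X.
have szh : (size h <= 2)%N.
  rewrite (leq_trans (size_polyD _ _)) // size_polyN size_polyX geq_max andbT.
  by rewrite (leq_trans (size_polyC_leq1 _)).
have [y Ey] := span_correction m ds z h _ dds pds sds ln szh.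
exists y => t x t0; rewrite (last_nth [::]).
have -> : nth [::] ([::] :: ds) (size ds) = nth [::] ds (size ds).-1.
  by case: ds n0 {dds pds sds ds0 dS ln Ey}.
have dd k : (k < size ds)%N -> degree_sequence m (nth [::] ds k).
  by move=> kn; apply: (allP dds); apply: mem_nth.
have dkS k : (k < size ds)%N -> (nth [::] ds k)`_m = S.
  by move=> kn; apply: dS; apply: mem_nth.
have lt_e k : (k < size ds)%N -> (nth [::] ds k)`_m < S + t.
  by move=> kn; rewrite dkS // ltrDl.
have vE (u : position) : h.[u.2%:~R] + t%:~R = (S + t - u.2)%:~R.
  by rewrite /h !hornerE intrB intrD; ring.
have pE k (u : position) : (k < size ds)%N ->
    pure (rcons (nth [::] ds k) (S + t)) u * (h.[u.2%:~R] + t%:~R) = pure (nth [::] ds k) u.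
  by move=> kn; rewrite vE -(pure_rcons m) ?dd ?lt_e.
pose D k := rcons (nth [::] ds k) (S + t).
pose p : position := (m.+1, S + t).
have dD k : (k < size ds)%N -> degree_sequence m.+1 (D k).
  by move=> kn; rewrite degree_sequence_rcons ?dd ?lt_e.
have pl : p \in positions (0 : int) (D (size ds).-1).
  have /degree_sequenceP[sd _] := dd _ ln.
  by rewrite mem_positions size_rcons sd /= ltnSn nth_rcons sd ltnn eqxx eqxx.
have zero k (u : position) : (k < size ds)%N -> pure (D k) u != 0 ->
    h.[u.2%:~R] + t%:~R = 0 -> u = p.
  move=> kn; have /degree_sequenceP[sd ltd] := dd _ kn.
  rewrite (pure_neq0 _ (dD _ kn)) vE.
  case: u => i j /= /andP[im /eqP->]; rewrite /= nth_rcons sd.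
  move: im; rewrite leq_eqVlt => /predU1P[->|im]; first by rewrite ltnn eqxx.
  rewrite im => /eqP; rewrite intr_eq0 subr_eq0 => /eqP E; move: (lt_e _ kn).
  rewrite E; move: im; rewrite ltnS leq_eqVlt => /predU1P[->|im]; first by rewrite ltxx.
  by rewrite ltNge ltW ?ltd.
have span (u : position) :
    \sum_(k < size ds) z k *
      ((pure (D k) u * (h.[u.2%:~R] + t%:~R) -
        pure (D (size ds).-1) u * (h.[u.2%:~R] + t%:~R)) * h.[u.2%:~R]) =
    \sum_(k < size ds) y`_k * (pure (D k) u * (h.[u.2%:~R] + t%:~R)).
  under eq_bigr => k _ do rewrite !pE //.
  by rewrite Ey; apply: eq_bigr => k _; rewrite pE.
have := lift_combination m (size ds) (size ds).-1 z (fun k => y`_k) D p h t%:~R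
  m0 ln szh dD pl zero span x.
rewrite (_ : h.[x.2%:~R] = (S - x.2)%:~R); last by rewrite /h !hornerE intrB.
move=> <-; apply: eq_bigr => k _.
by rewrite -(pE k x) // /h !hornerE intrB.
Qed.

(** The mirror image of [lift_low]: now h = j - t, the factor h + t = j turns raised sequences into
    shifted ones, and the exceptional position is the origin (0, 0). *)
Lemma lift_high (m : nat) (ds : seq (seq int)) (z : nat -> rat) :
  (0 < m)%N ->
  all (degree_sequence m) ds -> sorted precedes ds -> sorted steps_simple ds ->
  ds != [::] -> (forall d, d \in ds -> d`_0 = 0) ->
  exists w : seq rat, forall (t : int) (x : position), 0 < t ->
    \sum_(k < size ds) z k * shift t (pure (nth [::] ds k)) x =
    \sum_(k < size ds)
      (z k * t%:~R + w`_k) * pure (raise t (nth [::] ds k)) x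
    - (\sum_(k < size ds) z k) *
      (pure (raise t (head [::] ds)) x * (t - x.2)%:~R).
Proof.
move=> m0 dds pds sds ds0 d00.
have n0 : (0 < size ds)%N by rewrite lt0n size_eq0.
have szX : (size ('X : {poly rat}) <= 2)%N by rewrite size_polyX.
have [y Ey] := span_correction m ds z 'X _ dds pds sds n0 szX.
exists y => t x t0; rewrite -nth0.
have dd k : (k < size ds)%N -> degree_sequence m (nth [::] ds k).
  by move=> kn; apply: (allP dds); apply: mem_nth.
have gt0 k : (k < size ds)%N -> 0 < (nth [::] ds k)`_0 + t.
  by move=> kn; rewrite d00 ?add0r // mem_nth.
(* The correction was computed with ['X] in the unshifted degrees. Degree j of the shifted diagram
   is degree j - t of the original, so ['X] there corresponds to this [h], and the correction itself
   is free of t. *)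
pose h : {poly rat} := 'X - (t%:~R)%:P.
have szh : (size h <= 2)%N.
  rewrite (leq_trans (size_polyD _ _)) // size_polyN size_polyX geq_max /=.
  by rewrite (leq_trans (size_polyC_leq1 _)).
have hE (u : position) : h.[u.2%:~R] = (u.2 - t)%:~R by rewrite /h !hornerE intrB.
have vE (u : position) : h.[u.2%:~R] + t%:~R = u.2%:~R by rewrite hE intrB subrK.
have pE k (u : position) : (k < size ds)%N ->
    pure (raise t (nth [::] ds k)) u * (h.[u.2%:~R] + t%:~R) =
    shift t (pure (nth [::] ds k)) u.
  by move=> kn; rewrite vE -(shift_pure m) ?dd ?gt0.
pose D k := raise t (nth [::] ds k).
pose p : position := (0%N, 0).
have dD k : (k < size ds)%N -> degree_sequence m.+1 (D k).
  by move=> kn; rewrite degree_sequence_raise ?dd ?gt0.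
have pl : p \in positions (0 : int) (D 0%N) by rewrite mem_positions /= eqxx.
have zero k (u : position) : (k < size ds)%N -> pure (D k) u != 0 ->
    h.[u.2%:~R] + t%:~R = 0 -> u = p.
  move=> kn; have /degree_sequenceP[sd ltd] := dd _ kn.
  rewrite (pure_neq0 _ (dD _ kn)) vE.
  case: u => -[|i] j /=; first by move=> /eqP->.
  case/andP=> im /eqP->.
  rewrite /= (nth_map 0) ?sd // => /eqP; rewrite intr_eq0 gt_eqF //.
  by case: i im => [_|i im]; rewrite ?gt0 // (lt_trans (gt0 _ kn)) // ltrD2r ltd.
have span (u : position) :
    \sum_(k < size ds) z k *
      ((pure (D k) u * (h.[u.2%:~R] + t%:~R) - pure (D 0%N) u * (h.[u.2%:~R] + t%:~R))
        * h.[u.2%:~R]) =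
    \sum_(k < size ds) y`_k * (pure (D k) u * (h.[u.2%:~R] + t%:~R)).
  under eq_bigr => k _ do rewrite !pE //.
  under [in RHS]eq_bigr => k _ do rewrite pE //.
  case: u => -[|i] j; rewrite /shift /=.
    by rewrite !big1 // => k _; rewrite ?subrr ?mul0r mulr0.
  by rewrite -Ey; apply: eq_bigr => k _; rewrite hornerX -(hE (i, j)).
have := lift_combination m (size ds) 0 z (fun k => y`_k) D p h t%:~R
  m0 n0 szh dD pl zero span x.
rewrite hE -(opprB t x.2) intrN !mulrN => <-.
by apply: eq_bigr => k _; rewrite -(pE k x) // hE -(opprB t x.2) intrN.
Qed.

(** The embeddings [lo] and [hi] of low and high degrees are parameters: [id] and translation by t
    give honest degree sequences, while tagging with a boolean gives symbolic ones, needed to state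
    independence of t. *)
Definition bridge {T : Type} (lo hi : int -> T) (d d' : seq int) (r : nat) : seq T :=
  map lo (take r.+1 d) ++ map hi (drop r d').

Lemma nth_bridge (m : nat) (d d' : seq int) (t : int) (r k : nat) :
  degree_sequence m d -> degree_sequence m d' -> (r <= m)%N -> (k <= m.+1)%N ->
  (bridge id (+%R^~ t) d d' r)`_k = if (k <= r)%N then d`_k else d'`_k.-1 + t.
Proof.
move=> /degree_sequenceP[sd _] /degree_sequenceP[sd' _] rm km.
rewrite /bridge map_id nth_cat size_takel ?sd // ltnS.
case: leqP => kr; first by rewrite nth_take.
case: k km kr => // k km kr; rewrite (nth_map 0) ?size_drop ?sd' ?nth_drop ?subSS.
  by rewrite subnKC.
by rewrite ltn_sub2r // (leq_ltn_trans _ km).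
Qed.

Lemma degree_sequence_bridge (m : nat) (d d' : seq int) (t : int) (r : nat) :
  degree_sequence m d -> degree_sequence m d' -> (r <= m)%N -> d`_m < d'`_0 + t ->
  degree_sequence m.+1 (bridge id (+%R^~ t) d d' r).
Proof.
move=> dd dd' rm dt; apply/degree_sequenceP.
have /degree_sequenceP[sd ltd] := dd; have /degree_sequenceP[sd' ltd'] := dd'.
split=> [|i j ij jm].
  by rewrite size_cat !size_map size_takel ?sd // size_drop sd' addSn subnKC // leqW.
have led k : (k <= m)%N -> d`_k <= d`_m.
  by rewrite leq_eqVlt => /predU1P[->//|km]; rewrite ltW ?ltd.
have led' k : (k <= m)%N -> d'`_0 <= d'`_k.
  by case: k => // k km; rewrite ltW ?ltd'.
have im : (i <= m.+1)%N by rewrite (leq_trans (ltnW ij)).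
rewrite (nth_bridge m) // (nth_bridge m) //.
case: (leqP j r) => jr.
  by rewrite (leq_trans (ltnW ij) jr) ltd // (leq_trans jr).
case: j jm ij jr => // j jm ij jr /=; case: leqP => ir.
  by rewrite (le_lt_trans (led _ (leq_trans ir rm))) // (lt_le_trans dt) // lerD2r led'.
by case: i ij ir {im} => // i ij ir; rewrite /= ltrD2r ltd'.
Qed.

Lemma bridge_top (m : nat) (d d' : seq int) (t : int) :
  degree_sequence m d -> degree_sequence m d' ->
  bridge id (+%R^~ t) d d' m = rcons d (d'`_m + t).
Proof.
move=> /degree_sequenceP[sd _] /degree_sequenceP[sd' _].
rewrite /bridge map_id take_oversize ?sd // (drop_nth 0) ?sd' //.
by rewrite drop_oversize ?sd' // cats1.
Qed.

Lemma bridge_bottom (m : nat) (d d' : seq int) (t : int) :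
  degree_sequence m d -> d`_0 = 0 -> bridge id (+%R^~ t) d d' 0 = raise t d'.
Proof. by move=> /degree_sequenceP[+ _]; case: d => //= x d _ ->; rewrite /bridge /= take0 drop0. Qed.

(** The bridges r + 1 and r differ only in column r + 1, so [exchange_degree] gives a second
    expression for [W r.+1] as a multiple of bridge r. Subtracting [W r] gives the r-th summand, and
    the sum collapses to [W m - W 1], whose terms are multiples of the bridges m and 0, that is, of
    the appended and the raised sequence. *)
Lemma bridge_telescope (m : nat) (d d' : seq int) (t : int) (x : position) :
  (0 < m)%N -> degree_sequence m d -> degree_sequence m d' ->
  d`_0 = 0 -> d'`_0 = 0 -> d`_m < t ->
  \sum_(1 <= r < m)
    ((d'`_r + t) - d`_r)%:~R * pure (bridge id (+%R^~ t) d d' r) x =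
  pure (rcons d (d'`_m + t)) x * (d`_m - x.2)%:~R
    - pure (raise t d') x * (t - x.2)%:~R.
Proof.
move=> m0 dd dd' d0 d'0 dt.
have dt' : d`_m < d'`_0 + t by rewrite d'0 add0r.
pose e r := bridge id (+%R^~ t) d d' r.
pose W r : rat := pure (e r) x * (d`_r - x.2)%:~R.
have ex r : (r < m)%N -> W r.+1 = pure (e r) x * (d'`_r + t - x.2)%:~R.
  move=> rm; have rm' := ltnW rm; have rm1 : (r.+1 <= m.+1)%N by rewrite ltnS.
  have := exchange_degree m.+1 r.+1 (e r.+1) (e r) x.
  rewrite /W (nth_bridge m _ _ _ r.+1 r.+1) // leqnn.
  rewrite (nth_bridge m _ _ _ r r.+1) // ltnn; apply=> //.
  - exact: degree_sequence_bridge.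
  - exact: degree_sequence_bridge.
  - move=> k km kr; rewrite !(nth_bridge m) //.
    by rewrite [(k <= r.+1)%N]leq_eqVlt (negbTE kr) ltnS.
transitivity (\sum_(1 <= r < m) (W r.+1 - W r)).
  rewrite !big_nat; apply: eq_bigr => r /andP[_ rm].
  by rewrite ex // /W -mulrBr -intrB mulrC; congr (_ * _%:~R); ring.
rewrite telescope_sumr // /W -/(e m) /e (bridge_top m) //; congr (_ - _).
by rewrite -/(W 1%N) ex // /e (bridge_bottom m) // d'0 add0r.
Qed.

(** * Betti diagrams of complete intersections *)

Lemma big_set_ord_recr (R : nmodType) (n : nat) (F : {set 'I_n.+1} -> R) :
  let w := widen_ord (leqnSn n) in
  \sum_(T : {set 'I_n.+1}) F T =
  \sum_(T : {set 'I_n}) (F (w @: T) + F (ord_max |: w @: T)).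
Proof.
move=> w.
have w_inj : injective w by move=> i j /(congr1 val)/= /val_inj.
have w_max i : w i != ord_max by rewrite -val_eqE /= neq_ltn ltn_ord.
have w_onto j : j != ord_max -> exists i, j = w i.
  move=> jm; have jn : (j < n)%N.
    by rewrite ltn_neqAle -ltnS ltn_ord andbT; apply: contraNneq jm => jE; apply/eqP/val_inj.
  by exists (Ordinal jn); apply: val_inj.
have maxN (T : {set 'I__}) : ord_max \notin w @: T.
  by apply/imsetP => -[i _ /esym/eqP]; rewrite (negbTE (w_max i)).
rewrite big_split /= [LHS](bigID (fun T : {set 'I_n.+1} => ord_max \in T)) /= addrC.
congr (_ + _).
  rewrite (reindex_onto (fun T : {set 'I_n} => w @: T) (fun T => w @^-1: T)) /=.
    apply: eq_bigl => T; rewrite maxN /=; apply/eqP/setP => i.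
    by rewrite inE mem_imset.
  move=> T maxT; apply/setP => j; apply/imsetP/idP => [[i]|jT].
    by rewrite inE => iT ->.
  have [|i ji] := w_onto j; first by apply: contraNneq maxT => <-.
  by exists i => //; rewrite inE -ji.
rewrite (reindex_onto (fun T : {set 'I_n} => ord_max |: w @: T) (fun T => w @^-1: T)) /=.
  apply: eq_bigl => T; rewrite !inE eqxx /=; apply/eqP/setP => i.
  by rewrite !inE (negbTE (w_max i)) mem_imset.
move=> T maxT; apply/setP => j; rewrite !inE.
have [->|/w_onto[i ->]] := eqVneq j ord_max; first by rewrite maxT.
by rewrite mem_imset // inE.
Qed.

(** The index bound n is kept apart from [size a] so that, for [rcons a t], the subsets can be taken
    in a type whose bound is a successor and split according to the last generator. *)
Lemma ci_bettiE (a : seq nat) (n : nat) (x : position) : size a = n ->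
  ci_betti a x =
  \sum_(T : {set 'I_n}) ((#|T|, (\sum_(i in T) nth 0 a i)%N%:Z) == x)%:R.
Proof.
move=> <-{n}; have -> : ci_betti a x =
    #|[set T : {set 'I_(size a)} | ci_position T == x]|%:R.
  rewrite fsfunE; case: ifPn => // nx; apply/esym/eqP.
  rewrite pnatr_eq0 cards_eq0; apply/eqP/setP => T; rewrite !inE.
  by apply: contraNF nx => /eqP <-; apply/imfsetP; exists T.
by rewrite -sum1_card natr_sum big_mkcond; apply: eq_bigr => T _; rewrite inE; case: eqP.
Qed.

Lemma ci_betti_rcons (a : seq nat) (t : nat) (x : position) :
  ci_betti (rcons a t) x = ci_betti a x + shift t (ci_betti a) x.
Proof.
rewrite (ci_bettiE _ (size a).+1) ?size_rcons // (ci_bettiE a (size a)) //.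
rewrite big_set_ord_recr big_split /=; set w := widen_ord _.
have w_inj : injective w by move=> i j /(congr1 val)/= /val_inj.
have maxN (T : {set 'I__}) : ord_max \notin w @: T.
  by apply/imsetP => -[i _ /(congr1 val)/= E]; have := ltn_ord i; rewrite -E ltnn.
have sumE (T : {set 'I_(size a)}) : (\sum_(i in w @: T) nth 0 (rcons a t) i = \sum_(i in T) nth 0 a i)%N.
  rewrite big_imset /=; last by move=> ? ? _ _ /w_inj.
  by apply: eq_bigr => i _; rewrite nth_rcons ltn_ord.
congr (_ + _).
  by apply: eq_bigr => T _; rewrite card_imset // sumE.
case: x => -[|i] j; rewrite /shift /=.
  by rewrite big1 // => T _; rewrite xpair_eqE cardsU1 maxN.
rewrite (ci_bettiE a (size a)) //; apply: eq_bigr => T _.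
rewrite cardsU1 maxN card_imset // add1n big_setU1 //= sumE nth_rcons ltnn eqxx.
rewrite !xpair_eqE eqSS; congr ((_ && _)%:R).
by rewrite PoszD addrC eq_sym -subr_eq eq_sym.
Qed.

Lemma ci_betti_neq0 (a : seq nat) (x : position) : ci_betti a x != 0 ->
  exists T : {set 'I_(size a)}, x = (#|T|, (\sum_(i in T) nth 0 a i)%N%:Z).
Proof.
rewrite (ci_bettiE a (size a)) // => ax.
have [] := pickP (fun T : {set 'I_(size a)} => (#|T|, (\sum_(i in T) nth 0 a i)%N%:Z) == x).
  by move=> T /eqP <-; exists T.
by move=> nT; move: ax; rewrite big1 ?eqxx // => T _; rewrite nT.
Qed.

Lemma ci_betti_first (a : seq nat) (j : int) : ci_betti a (0%N, j) != 0 -> j = 0.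
Proof.
move=> /ci_betti_neq0[T [/esym/eqP + ->]].
by rewrite cards_eq0 => /eqP->; rewrite big_set0.
Qed.

Lemma ci_betti_last (a : seq nat) (j : int) :
  ci_betti a (size a, j) != 0 -> j = sumn a.
Proof.
move=> /ci_betti_neq0[T [cT ->]]; congr Posz.
have -> : T = setT by apply/eqP; rewrite eqEcard subsetT -cT cardsT card_ord /=.
rewrite sumnE (big_nth 0%N) big_mkord; apply: eq_bigl => i; exact: in_setT.
Qed.

Lemma ci_betti_origin (a : seq nat) : ci_betti a (0%N, 0) != 0.
Proof.
rewrite (ci_bettiE a (size a)) // -natr_sum pnatr_eq0 -lt0n (bigD1 set0) //=.
by rewrite cards0 big_set0 eqxx.
Qed.

(** * The lifted chain: its sum, its order and the sign of its coefficients *)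

Definition lifted {T : Type} (lo hi : int -> T) (m : nat) (S : int)
    (ds : seq (seq int)) : seq (seq T) :=
  [seq rcons (map lo d) (hi S) | d <- ds]
  ++ [seq bridge lo hi (last [::] ds) (head [::] ds) r | r <- rev (iota 1 m.-1)]
  ++ [seq lo 0 :: map hi d | d <- ds].

(** Only the bridges with 0 < r < m are listed: bridge m is the last appended sequence and bridge 0
    the first raised one. They come by decreasing r because each passage from r + 1 to r raises a
    degree. *)
Definition lift_chain (m : nat) (S : int) (s : seq (rat * seq int)) (y w : seq rat)
    (t : int) : seq (rat * seq int) :=
  let d k := nth [::] (unzip2 s) k in
  let z k := (unzip1 s)`_k in
  let first := head [::] (unzip2 s) in
  let final := last [::] (unzip2 s) in
  [seq (z k * t%:~R + y`_k, rcons (d k) (S + t)) | k <- iota 0 (size s)]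
  ++ [seq ((\sum_(u <- s) u.1) * (first`_r + t - final`_r)%:~R,
           bridge id (+%R^~ t) final first r) | r <- rev (iota 1 m.-1)]
  ++ [seq (z k * t%:~R + w`_k, raise t (d k)) | k <- iota 0 (size s)].

Lemma unzip2_lift_chain (m : nat) (S : int) (s : seq (rat * seq int)) (y w : seq rat)
    (t : int) :
  unzip2 (lift_chain m S s y w t) = lifted id (+%R^~ t) m S (unzip2 s).
Proof.
rewrite /lift_chain /lifted /unzip2 !map_cat.
have E (f : seq int -> seq int) : [seq f (nth [::] [seq u.2 | u <- s] k) | k <- iota 0 (size s)]
    = [seq f u.2 | u <- s].
  rewrite -[RHS]/(map (f \o snd) s) map_comp.
  rewrite -[LHS]/(map (f \o nth [::] (map snd s)) (iota 0 (size s))) map_comp.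
  by congr map; rewrite -(size_map snd) -/(mkseq _ _) mkseq_nth.
congr (_ ++ (_ ++ _)); rewrite -!map_comp.
- apply: (etrans (E (fun d => rcons d (S + t)))).
  by apply: eq_map => u /=; rewrite map_id.
- exact: eq_map.
- exact: (E (raise t)).
Qed.

Lemma size_lift_chain (m : nat) (S : int) (s : seq (rat * seq int)) (y w : seq rat)
    (t : int) : size (lift_chain m S s y w t) = (size s + (m.-1 + size s))%N.
Proof. by rewrite !size_cat !size_map size_rev !size_iota. Qed.

Lemma combinationE (s : seq (rat * seq int)) (x : position) :
  combination s x =
  \sum_(k < size (unzip2 s)) (unzip1 s)`_k * pure (nth [::] (unzip2 s) k) x.
Proof.
rewrite /combination (big_nth (0, [::])) big_mkord size_map; apply: eq_bigr => k _.
by rewrite (nth_map (0, [::])) // (nth_map (0, [::])).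
Qed.

(** The errors of [lift_low] and [lift_high] carry the same factor, the sum of all coefficients, and
    their difference is exactly the telescoped sum over the bridges. *)
Lemma lift_chain_combination (m : nat) (S : int) (s : seq (rat * seq int)) :
  (0 < m)%N -> s != [::] -> positive_chain m s -> sorted steps_simple (unzip2 s) ->
  (forall d, d \in unzip2 s -> d`_0 = 0) -> (forall d, d \in unzip2 s -> d`_m = S) ->
  exists y, exists w, forall (t : int) (x : position), 0 < t -> S < t ->
    combination s x + shift t (combination s) x =
    combination (lift_chain m S s y w t) x.
Proof.
move=> m0 s0 /and3P[_ dds pds] sds d0 dS.
have {}dds : all (degree_sequence m) (unzip2 s) by rewrite all_map.
have ds0 : unzip2 s != [::] by case: s s0 {pds sds d0 dS dds}.
have [y Ey] := lift_low m (unzip2 s) (fun k => (unzip1 s)`_k) S m0 dds pds sds ds0 dS.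
have [w Ew] := lift_high m (unzip2 s) (fun k => (unzip1 s)`_k) m0 dds pds sds ds0 d0.
exists y, w => t x t0 St.
have headP : head [::] (unzip2 s) \in unzip2 s.
  by case: (unzip2 s) ds0 => //= d ds _; rewrite mem_head.
have lastP : last [::] (unzip2 s) \in unzip2 s.
  by case: (unzip2 s) ds0 => //= d ds _; rewrite mem_last.
have -> : shift t (combination s) x =
   \sum_(k < size (unzip2 s)) (unzip1 s)`_k * shift t (pure (nth [::] (unzip2 s) k)) x.
  rewrite /shift; case: x.1 => [|i]; last exact: combinationE.
  by rewrite big1 // => k _; rewrite mulr0.
rewrite combinationE (Ey t) // (Ew t) // /combination /lift_chain !big_cat !big_map /=.
have -> : iota 0 (size s) = index_iota 0 (size s) by rewrite /index_iota subn0.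
rewrite !big_mkord size_map.
have sumz : \sum_(k < size s) (unzip1 s)`_k = \sum_(u <- s) u.1.
  rewrite (big_nth (0, [::])) big_mkord; apply: eq_bigr => k _.
  by rewrite (nth_map (0, [::])).
rewrite sumz -addrA; congr (_ + _); rewrite addrCA [RHS]addrC; congr (_ + _).
rewrite -mulrBr.
have := bridge_telescope m (last [::] (unzip2 s)) (head [::] (unzip2 s)) t x m0.
rewrite !(allP dds) // !d0 // !dS // => /(_ isT isT erefl erefl St) <-.
rewrite mulr_sumr [RHS](perm_big (iota 1 m.-1)) ?perm_rev //= /index_iota subn1.
by apply: eq_bigr => r _; rewrite mulrA.
Qed.

Lemma path_rev_iota (T : Type) (e : rel T) (f : nat -> T) (n : nat) :
  (forall r, (r < n)%N -> e (f r.+1) (f r)) -> path e (f n) [seq f r | r <- rev (iota 0 n)].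
Proof.
elim: n => [//|n IH] ef; rewrite -addn1 iotaD rev_cat /= addn1 ef //=.
by apply: IH => r rn; apply: ef; apply: ltnW.
Qed.

Lemma rev_iota0 (n : nat) :
  (0 < n)%N -> rev (iota 0 n) = rcons (rev (iota 1 n.-1)) 0%N.
Proof. by case: n => //= n _; rewrite rev_cons. Qed.

(** Counting the first raised sequence as bridge 0 makes the passage between the families uniform,
    and leaves a nonempty family of bridges even for m = 1. *)
Lemma lifted_bridges (m : nat) (S t : int) (d : seq int) (ds : seq (seq int)) :
  (0 < m)%N -> all (degree_sequence m) (d :: ds) -> d`_0 = 0 -> d`_m = S ->
  (last d ds)`_0 = 0 ->
  lifted id (+%R^~ t) m S (d :: ds) =
  [seq rcons e (S + t) | e <- d :: ds]
  ++ [seq bridge id (+%R^~ t) (last d ds) d r | r <- rev (iota 0 m)]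
  ++ [seq raise t e | e <- ds].
Proof.
move=> m0 dds d0 dm l0; rewrite /lifted.
have ldd : degree_sequence m (last d ds) by apply: (allP dds); apply: mem_last.
congr (_ ++ _); first by apply: eq_map => e; rewrite map_id.
by rewrite rev_iota0 // map_rcons cat_rcons (bridge_bottom m).
Qed.

Lemma precedes_rcons (d d' : seq int) (e : int) :
  precedes d d' -> precedes (rcons d e) (rcons d' e).
Proof.
move=> /andP[le ne]; rewrite /precedes eqseq_rcons eqxx andbT ne andbT.
by elim: d d' le {ne} => [|x d IH] [|x' d'] //= => [_|/andP[-> /IH//]]; rewrite lexx.
Qed.

Lemma precedes_raise (d d' : seq int) (t : int) :
  precedes d d' -> precedes (raise t d) (raise t d').
Proof.
move=> /andP[le ne]; rewrite /precedes /raise /=; apply/andP; split.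
  by elim: d d' le {ne} => [|x d IH] [|x' d'] //= /andP[xx' /IH->]; rewrite lerD2r xx'.
by rewrite eqseq_cons eqxx /= (inj_eq (inj_map (addIr t))).
Qed.

Lemma precedes_bridge (m r : nat) (d d' : seq int) (t : int) :
  degree_sequence m d -> degree_sequence m d' -> d`_m < d'`_0 + t -> (r < m)%N ->
  precedes (bridge id (+%R^~ t) d d' r.+1) (bridge id (+%R^~ t) d d' r).
Proof.
move=> dd dd' dt rm; have rm' := ltnW rm.
apply/(precedesP m.+1); rewrite ?degree_sequence_bridge //.
have /degree_sequenceP[sd ltd] := dd; have /degree_sequenceP[sd' ltd'] := dd'.
have lt_r : d`_r.+1 < d'`_r + t.
  have le1 : d`_r.+1 <= d`_m.
    by move: rm; rewrite leq_eqVlt => /predU1P[->//|rm]; rewrite ltW ?ltd.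
  have le2 : d'`_0 <= d'`_r by case: r rm' {rm le1} => // r rm'; rewrite ltW ?ltd'.
  by rewrite (le_lt_trans le1) // (lt_le_trans dt) // lerD2r.
split=> [k km|]; last first.
  have rm1 : (r.+1 <= m.+1)%N by rewrite ltnS.
  by exists r.+1; rewrite // !(nth_bridge m) // leqnn ltnn.
rewrite !(nth_bridge m) // [(k <= r.+1)%N]leq_eqVlt ltnS.
by case: eqVneq => [->|_] /=; rewrite ?lexx // ltnn ltW.
Qed.

Lemma precedes_lifted (m : nat) (S t : int) (ds : seq (seq int)) :
  (0 < m)%N -> ds != [::] -> all (degree_sequence m) ds -> sorted precedes ds ->
  (forall d, d \in ds -> d`_0 = 0) -> (forall d, d \in ds -> d`_m = S) -> S < t ->
  all (degree_sequence m.+1) (lifted id (+%R^~ t) m S ds) /\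
  sorted precedes (lifted id (+%R^~ t) m S ds).
Proof.
case: ds => // d ds m0 _ dds pds d0 dS St.
have dP := mem_head d ds; have lP := mem_last d ds.
have dd := allP dds; have t0 : 0 < t.
  have /degree_sequenceP[_ ltd] := dd _ dP.
  have := ltd 0%N m m0 (leqnn m).
  by rewrite d0 // dS // => /lt_trans; apply.
have lt : (last d ds)`_m < d`_0 + t by rewrite dS // d0 // add0r.
rewrite (lifted_bridges m) ?d0 ?dS //; split.
  rewrite !all_cat !all_map; apply/and3P; split; apply/allP => e /=.
  - by move=> eds; rewrite degree_sequence_rcons ?dd // dS // ltrDl.
  - rewrite mem_rev mem_iota add0n => /= em.
    by rewrite degree_sequence_bridge ?dd // ltnW.
  - move=> eds; have ed : e \in d :: ds by rewrite inE eds orbT.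
    by rewrite degree_sequence_raise ?dd // d0 // add0r.
rewrite map_cons cat_cons /= cat_path; apply/andP; split.
  by apply: (homo_path (f := fun e => rcons e (S + t))) pds => e e'; apply: precedes_rcons.
(* As all sequences end in S, the last appended sequence is bridge m, from which the descending path
   of bridges starts. *)
rewrite (last_map (fun e => rcons e (S + t))) -[S in rcons _ (S + t)](dS _ dP).
rewrite -(bridge_top m) ?dd //.
rewrite cat_path path_rev_iota /= => [|r rm]; last by rewrite (precedes_bridge m) ?dd.
have -> : last (bridge id (+%R^~ t) (last d ds) d m)
   [seq bridge id (+%R^~ t) (last d ds) d r | r <- rev (iota 0 m)] = raise t d.
  by rewrite last_map rev_iota0 // last_rcons (bridge_bottom m) ?dd ?d0.
by apply: homo_path pds => e e'; apply: precedes_raise.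
Qed.

(** For the end coefficients of the lifted chain: nothing is known about the sign of the constants,
    but the slopes are positive and dominate once t exceeds every |y_k / z_k|. *)
Lemma eventually_gt0 (n : nat) (z y : nat -> rat) :
  (forall k, (k < n)%N -> 0 < z k) ->
  exists N : nat, forall t k, (N < t)%N -> (k < n)%N -> 0 < z k * t%:R + y k.
Proof.
elim: n => [|n IH] z0; first by exists 0%N.
have [|N NP] := IH; first by move=> k kn; apply: z0; apply: ltnW.
exists (maxn N (Num.bound `|y n / z n|)) => t k; rewrite gtn_max => /andP[Nt bt].
rewrite ltnS leq_eqVlt => /predU1P[->|kn]; last exact: NP.
have zn := z0 n (ltnSn n).
have lt_t : `|y n / z n| < t%:R.
  by rewrite (lt_trans (archi_boundP (normr_ge0 _))) ?ltr_nat.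
have -> : z n * t%:R + y n = z n * (t%:R + y n / z n).
  by rewrite mulrDr mulrCA divff ?mulr1 // gt_eqF.
rewrite pmulr_rgt0 // -ltrBlDr sub0r (le_lt_trans _ lt_t) //.
by rewrite -normrN ler_norm.
Qed.

(** * Elimination order of the lifted chain: compatibility and independence of t *)

Lemma departures_cat {T : eqType} (x0 : T) (L R : seq (seq T)) (d d' : seq T) :
  departures x0 (rcons L d ++ d' :: R) =
  take (size L) (departures x0 (rcons L d))
  ++ departing x0 d d' :: departures x0 (d' :: R).
Proof.
elim: L => [//|e L IH].
have -> : departures x0 (rcons (e :: L) d ++ d' :: R) =
    departing x0 e (head [::] (rcons L d)) :: departures x0 (rcons L d ++ d' :: R).
  by case: L {IH}.
have -> : departures x0 (rcons (e :: L) d) =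
    departing x0 e (head [::] (rcons L d)) :: departures x0 (rcons L d).
  by case: L {IH}.
by rewrite IH.
Qed.

Lemma departing_rcons {T : eqType} (x0 : T) (d d' : seq T) (e : T) :
  size d = size d' -> departing x0 (rcons d e) (rcons d' e) = departing x0 d d'.
Proof.
move=> sdd'; rewrite /departing size_rcons -addn1 iotaD add0n filter_cat /=.
rewrite !nth_rcons -sdd' ltnn !eqxx cats0.
have -> : [seq i <- iota 0 (size d) | nth x0 (rcons d e) i != nth x0 (rcons d' e) i]
    = [seq i <- iota 0 (size d) | nth x0 d i != nth x0 d' i].
  by apply: eq_in_filter => i; rewrite mem_iota add0n !nth_rcons -sdd' => /= ->.
apply/eq_in_map => i; rewrite mem_filter mem_iota add0n => /and3P[_ _ id].
by rewrite nth_rcons id.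
Qed.

Lemma departures_rcons {T : eqType} (x0 : T) (m : nat) (L : seq (seq T)) (e : T) :
  all (fun d => size d == m) L ->
  take (size L).-1 (departures x0 [seq rcons d e | d <- L]) =
  take (size L).-1 (departures x0 L).
Proof.
elim: L => [//|d L IH] /= /andP[/eqP sd sL].
case: L IH sL => [//|d' L] IH /= sL; rewrite departing_rcons; last first.
  by case/andP: sL => /eqP-> _.
by congr cons; apply: IH.
Qed.

(** Departures only test degrees for equality, so they commute with any map that is injective on the
    degrees that occur, the default value included. *)
Lemma departures_map {T U : eqType} (f : T -> U) (P : pred T) (x0 : T)
    (L : seq (seq T)) :
  {in P &, injective f} -> P x0 -> all (all P) L ->
  departures (f x0) (map (map f) L) =
  [seq [seq (x.1, f x.2) | x <- E] | E <- departures x0 L].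
Proof.
move=> f_inj P0; have Pn d i : all P d -> P (nth x0 d i).
  move=> Pd; case: (ltnP i (size d)) => id; last by rewrite nth_default.
  by apply: (allP Pd); apply: mem_nth.
have nE (d : seq T) i : nth (f x0) (map f d) i = f (nth x0 d i).
  case: (ltnP i (size d)) => id; first exact: nth_map.
  by rewrite !nth_default ?size_map.
elim: L => [//|d L IH] /= /andP[Pd PL]; congr (_ :: _); last exact: IH.
case: L {IH} PL => [_|d' L /= /andP[Pd' _]] /=.
  by rewrite /positions size_map -map_comp; apply: eq_map => i /=; rewrite nE.
rewrite /departing size_map -map_comp.
have -> : [seq i <- iota 0 (size d) |
             nth (f x0) (map f d) i != nth (f x0) (map f d') i] =
    [seq i <- iota 0 (size d) | nth x0 d i != nth x0 d' i].
  apply: eq_filter => i; rewrite !nE; congr (~~ _).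
  by apply/eqP/eqP => [E|-> //]; apply: f_inj => //; apply: Pn.
by apply: eq_map => i /=; rewrite nE.
Qed.

Lemma map_lifted {T U : Type} (f : T -> U) (lo hi : int -> T) (m : nat) (S : int)
    (ds : seq (seq int)) :
  map (map f) (lifted lo hi m S ds) = lifted (f \o lo) (f \o hi) m S ds.
Proof.
rewrite /lifted !map_cat -!map_comp; congr (_ ++ (_ ++ _)); apply: eq_map => d /=.
- by rewrite map_rcons -map_comp.
- by rewrite /bridge map_cat -!map_comp.
- by rewrite -map_comp.
Qed.

Lemma eq_lifted {T : Type} (lo lo' hi hi' : int -> T) (P : pred int) (m : nat)
    (S : int) (ds : seq (seq int)) :
  {in P, lo =1 lo'} -> {in P, hi =1 hi'} -> P 0 -> P S -> all (all P) ds ->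
  lifted lo hi m S ds = lifted lo' hi' m S ds.
Proof.
move=> elo ehi P0 PS Pds.
have mapE (f f' : int -> T) d : {in P, f =1 f'} -> all P d -> map f d = map f' d.
  by move=> ff' /allP Pd; apply/eq_in_map => x /Pd; apply: ff'.
have Plast : all P (last [::] ds).
  by case: ds Pds => // d ds /allP; apply; rewrite /= mem_last.
have Phead : all P (head [::] ds) by case: ds Pds {Plast} => //= d ds /andP[].
congr (_ ++ (_ ++ _)).
- apply/eq_in_map => d /(allP Pds) Pd.
  by rewrite (mapE _ _ _ elo Pd) ehi.
- apply: eq_map => r; congr (_ ++ _); apply: mapE => //; apply/allP => x.
    by move/mem_take; apply: (allP Plast).
  by move/mem_drop; apply: (allP Phead).
- by apply/eq_in_map => d /(allP Pds) Pd; rewrite (mapE _ _ _ ehi Pd) elo.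
Qed.

Lemma all_lifted {T : Type} (lo hi : int -> T) (P : pred int) (Q : pred T) (m : nat)
    (S : int) (ds : seq (seq int)) :
  (forall j, P j -> Q (lo j) && Q (hi j)) -> P 0 -> P S -> all (all P) ds ->
  all (all Q) (lifted lo hi m S ds).
Proof.
move=> PQ P0 PS Pds.
have Qlo j : P j -> Q (lo j) by case/PQ/andP.
have Qhi j : P j -> Q (hi j) by case/PQ/andP.
have Plast : all P (last [::] ds).
  by case: ds Pds => // d ds /allP; apply; rewrite /= mem_last.
have Phead : all P (head [::] ds) by case: ds Pds {Plast} => //= d ds /andP[].
rewrite !all_cat !all_map; apply/and3P; split.
- apply: sub_all Pds => d Pd /=.
  by rewrite all_rcons Qhi // all_map; apply: sub_all Pd => j; apply: Qlo.
- apply/allP => r _ /=; rewrite all_cat !all_map; apply/andP; split; apply/allP => j.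
    by move/mem_take/(allP Plast)/Qlo.
  by move/mem_drop/(allP Phead)/Qhi.
- apply: sub_all Pds => d Pd /=.
  by rewrite Qlo //= all_map; apply: sub_all Pd => j; apply: Qhi.
Qed.

Definition instantiate (t : nat) (p : nat * bool) : int := (p.1 + p.2 * t)%N%:Z.

(** Below the bound t, the pair (j, b) consists of the remainder and the quotient of j + b t by
    t. *)
Lemma instantiate_inj (t : nat) :
  {in [pred p : nat * bool | (p.1 < t)%N] &, injective (instantiate t)}.
Proof.
move=> [j b] [j' b']; rewrite !inE /instantiate /= => jt jt' [].
by case: b; case: b'; rewrite ?mul1n ?mul0n => E; congr (_, _); lia.
Qed.

(** Appending a constant degree does not affect departures, so the first steps repeat those of [ds].
    The next step goes from bridge m to bridge m - 1, which only replaces S in column m by a larger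
    degree; this eliminates precisely the conventional last position (m, S). *)
Lemma departures_first_lift (m : nat) (S t : int) (ds : seq (seq int)) :
  (0 < m)%N -> ds != [::] -> all (degree_sequence m) ds ->
  (forall d, d \in ds -> d`_0 = 0) -> (forall d, d \in ds -> d`_m = S) -> S < t ->
  exists E R, departures 0 (lifted id (+%R^~ t) m S ds) =
    rcons (take (size ds).-1 (departures 0 ds)) E ++ R /\ E =i [:: (m, S)].
Proof.
case: ds => // d ds m0 _ dds d0 dS St.
have dP := mem_head d ds; have lP := mem_last d ds; have dd := allP dds.
rewrite (lifted_bridges m) ?d0 ?dS //.
set B := map _ (rev _); set R1 := map _ ds.
have EB : B = bridge id (+%R^~ t) (last d ds) d m.-1
              :: [seq bridge id (+%R^~ t) (last d ds) d r | r <- rev (iota 0 m.-1)].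
  by rewrite /B -{1}(prednK m0) -addn1 iotaD rev_cat.
rewrite EB cat_cons lastI map_rcons departures_cat.
set E := departing _ _ _; set X := departures _ (_ :: _ ++ R1).
exists E, X; split.
  rewrite cat_rcons; congr (_ ++ _).
  rewrite size_map size_belast -map_rcons -lastI.
  apply: (departures_rcons 0 m.+1 (d :: ds)).
  by apply: sub_all dds => e /degree_sequenceP[-> _].
have /degree_sequenceP[sl _] := dd _ lP; have m1m : (m.-1 <= m)%N by rewrite leq_pred.
have ltS : S < d`_m.-1 + t.
  have /degree_sequenceP[_ ltd] := dd _ dP.
  have : 0 <= d`_m.-1.
    case: m.-1 m1m => [|k] km; first by rewrite d0.
    by rewrite ltW // -[X in X < _](d0 _ dP) ltd.
  by move=> ?; rewrite (lt_le_trans St) // lerDr.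
case=> i j; rewrite mem_departing size_rcons sl inE /= xpair_eqE ltnS.
have rS : rcons (last d ds) (S + t) = bridge id (+%R^~ t) (last d ds) d m.
  by rewrite (bridge_top m) ?dd ?dS.
rewrite rS; case: (leqP i m.+1) => im /=; last by rewrite gtn_eqF // ltnW.
rewrite !(nth_bridge m) ?dd //; have [->{im i}|ne] := eqVneq i m.
  rewrite leqnn dS // leqNgt prednK // leqnn /=.
  by case: eqP => // ->; rewrite lt_eqF.
have -> : (i <= m.-1)%N = (i <= m)%N by rewrite [RHS]leq_eqVlt (negbTE ne) -ltnS prednK.
by rewrite andbN.
Qed.

Lemma size_departures {T : eqType} (x0 : T) (L : seq (seq T)) :
  size (departures x0 L) = size L.
Proof. by elim: L => //= d L ->. Qed.

Lemma nth_departures {T : eqType} (x0 : T) (L : seq (seq T)) (k : nat) :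
  (k.+1 < size L)%N ->
  nth [::] (departures x0 L) k = departing x0 (nth [::] L k) (nth [::] L k.+1).
Proof.
elim: L k => // d L IH [|k] /= kL; first by case: L {IH} kL.
exact: IH.
Qed.

(** * Assembly of the four assertions for large t *)

Lemma chain_origin_last (a : seq nat) (s : seq (rat * seq int)) (d : seq int) :
  positive_chain (size a) s -> ci_betti a =1 combination s -> d \in unzip2 s ->
  d`_0 = 0 /\ d`_(size a) = (sumn a)%:Z.
Proof.
move=> cs aE /mapP[u us ->]; have /and3P[_ /allP/(_ _ us) dd _] := cs.
have in_betti i : (i <= size a)%N -> ci_betti a (i, u.2`_i) != 0.
  move=> im; rewrite aE (combination_neq0 _ _ _ cs); apply/hasP; exists u => //.
  by rewrite (pure_neq0 _ dd) /= im eqxx.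
(* The first and the last column of the Betti diagram each have a single nonzero entry, coming from
   the empty and the full set of generators. *)
by split; [apply: (ci_betti_first a) | apply: ci_betti_last]; apply: in_betti.
Qed.

Lemma steps_simple_no_mass (L : seq (seq int)) :
  ~ mass_elimination [seq [fset x in E]%fset | E <- departures 0 L] ->
  sorted steps_simple L.
Proof.
move=> nm; apply/(sortedP [::]) => k kL; rewrite /steps_simple leqNgt; apply/negP => gt1.
case: nm; exists k; first by rewrite size_map size_departures.
rewrite (nth_map [::]) ?size_departures ?(ltnW kL) // nth_departures //.
by rewrite card_fseq undup_id ?uniq_departing.
Qed.

Lemma bounded_chain (m : nat) (S : int) (ds : seq (seq int)) :
  all (degree_sequence m) ds ->
  (forall d, d \in ds -> d`_0 = 0) -> (forall d, d \in ds -> d`_m = S) ->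
  all (all [pred j | 0 <= j <= S]) ds.
Proof.
move=> dds d0 dS; apply/allP => d d_ds; apply/(all_nthP 0) => i.
have /degree_sequenceP[sd ltd] := allP dds _ d_ds; rewrite sd ltnS => im /=.
rewrite -(dS _ d_ds); apply/andP; split.
  case: i im => [|i] im; first by rewrite d0.
  by rewrite ltW // -[X in X < _](d0 _ d_ds) ltd.
by move: im; rewrite leq_eqVlt => /predU1P[->//|im]; rewrite ltW ?ltd.
Qed.

Lemma shift_positionsE (t : nat) (E : seq (nat * (nat * bool))) :
  shift_positions t [fset x in [seq (x.1, x.2.1, x.2.2) | x <- E]]%fset =
  [fset x in [seq (x.1, instantiate t x.2) | x <- E]]%fset.
Proof.
apply/fsetP => x; rewrite !inE /=; apply/imfsetP/mapP => [[y + ->]|[y yE ->]] /=.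
  by rewrite inE /= => /mapP[u uE ->]; exists u.
by exists (y.1, y.2.1, y.2.2) => //; rewrite inE /=; apply/mapP; exists y.
Qed.

Lemma size_linear (K : fieldType) (z y : K) : z != 0 -> size (z%:P * 'X + y%:P) = 2%N.
Proof. by move=> z0; rewrite size_MXaddC polyC_eq0 (negbTE z0) size_polyC z0. Qed.

(** By [bs_decomposition_unique], [B t] is the Boij-Soederberg decomposition for the last degree t,
    so all clauses concern the Betti diagram itself. The last coefficients are counted from the end
    through [rev], and size 2 means degree exactly 1. *)
Theorem proposition3p2 (a : seq nat) (s : seq (rat * seq int)) :
  (0 < size a)%N ->
  all (fun x => (0 < x)%N) a ->
  sorted leq a ->
  bs_decomposition (size a) (ci_betti a) s ->
  ~ mass_elimination (elimination_order (ci_betti a) s) ->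
  exists2 N : nat, (0 < N)%N &
  exists2 B : nat -> seq (rat * seq int),
    (forall t : nat, (last 0 a <= t)%N -> (N < t)%N ->
       bs_decomposition (size a).+1 (ci_betti (rcons a t)) (B t)) &
    [/\ exists M : nat, forall t : nat, (last 0 a <= t)%N -> (N < t)%N ->
          size (B t) = M,
        forall t : nat, (last 0 a <= t)%N -> (N < t)%N ->
          compatible a (elimination_order (ci_betti a) s)
            (elimination_order (ci_betti (rcons a t)) (B t)),
        exists F : seq {fset nat * nat * bool},
          forall t : nat, (last 0 a <= t)%N -> (N < t)%N ->
          elimination_order (ci_betti (rcons a t)) (B t) =
            [seq shift_positions t Fk | Fk <- F]
      & forall k : nat, (k < size s)%N ->
          exists p q : {poly rat},
          [/\ size p = 2%N, size q = 2%N &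
              forall t : nat, (last 0 a <= t)%N -> (N < t)%N ->
              (bs_coefficients (B t))`_k = p.[t%:R] /\
              (rev (bs_coefficients (B t)))`_k = q.[t%:R]]].
Proof.
move=> a0 _ _ run; have [cs aE] := chain_of_greedy _ _ _ run.
have Ea := elimination_order_chain _ _ _ cs aE; rewrite Ea => /steps_simple_no_mass simple.
set m := size a in a0 run cs *; set S := (sumn a)%:Z.
have s0 : s != [::].
  by apply: contraNneq (ci_betti_origin a) => s0; rewrite aE s0 /combination big_nil.
have d0 d : d \in unzip2 s -> d`_0 = 0 by case/(chain_origin_last _ _ _ cs aE).
have dS d : d \in unzip2 s -> d`_m = S by case/(chain_origin_last _ _ _ cs aE).
have [y [w liftE]] := lift_chain_combination m S s a0 s0 cs simple d0 dS.
have /and3P[zs dds pds] := cs.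
have {}dds : all (degree_sequence m) (unzip2 s) by rewrite all_map.
have ds0 : unzip2 s != [::] by case: (s) s0.
have z0 k : (k < size s)%N -> 0 < (unzip1 s)`_k.
  by move=> ks; rewrite (nth_map (0, [::])) // (allP zs) ?mem_nth.
have [N1 N1P] := eventually_gt0 (size s) (fun k => (unzip1 s)`_k) (fun k => y`_k) z0.
have [N2 N2P] := eventually_gt0 (size s) (fun k => (unzip1 s)`_k) (fun k => w`_k) z0.
(* Exceeding the sum of the degrees separates low degrees from high ones; exceeding [N1] and [N2]
   makes the coefficients of the two outer families positive. *)
pose N := (maxn (sumn a) (maxn N1 N2)).+1; exists N => //.
pose B (t : nat) := lift_chain m S s y w t.
have Pds := bounded_chain m S (unzip2 s) dds d0 dS.
have S0 : 0 <= S by [].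
have bound d k : d \in unzip2 s -> 0 <= d`_k <= S.
  move=> d_ds; case: (ltnP k (size d)) => kd; last by rewrite nth_default // lexx.
  by apply: (allP (allP Pds _ d_ds)); apply: mem_nth.
have headP : head [::] (unzip2 s) \in unzip2 s.
  by case: (unzip2 s) ds0 => //= d ds _; rewrite mem_head.
have lastP : last [::] (unzip2 s) \in unzip2 s.
  by case: (unzip2 s) ds0 => //= d ds _; rewrite mem_last.
have large (t : nat) : (N < t)%N -> [/\ 0 < t%:Z, S < t%:Z, (N1 < t)%N & (N2 < t)%N].
  move=> /ltnW; rewrite !gtn_max => /and3P[at_ N1t N2t].
  by split; rewrite ?ltz_nat // (leq_ltn_trans _ at_).
have [precB degB] : (forall t : nat, (N < t)%N -> sorted precedes (unzip2 (B t))) /\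
    (forall t : nat, (N < t)%N -> all (degree_sequence m.+1) (unzip2 (B t))).
  by split=> t /large[_ St _ _]; rewrite unzip2_lift_chain;
    have [] := precedes_lifted m S t (unzip2 s) a0 ds0 dds pds d0 dS St.
have BE t : (N < t)%N -> ci_betti (rcons a t) =1 combination (B t).
  move=> /large[t0 St _ _] x; rewrite ci_betti_rcons -liftE // aE; congr (_ + _).
  by rewrite /shift; case: x.1.
have chainB t : (N < t)%N -> positive_chain m.+1 (B t).
  move=> Nt; have [t0 St N1t N2t] := large t Nt; apply/and3P; split; last exact: precB.
    rewrite !all_cat !all_map; apply/and3P; split; apply/allP => k /=.
    - by rewrite mem_iota => /= ks; apply: N1P.
    - rewrite mem_rev mem_iota => /andP[_ km]; rewrite mulr_gt0 //.
        case: (s) s0 zs => // u s' _ /= /andP[u0 /allP s'0].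
        rewrite big_cons ltr_pwDl // big_seq sumr_ge0 // => v /s'0.
        exact: ltW.
      (* The bridge coefficient has positive second factor because the degrees of the original chain
         lie between 0 and S, and S < t. *)
      have /andP[h0 _] := bound _ k headP; have /andP[_ lS] := bound _ k lastP.
      by rewrite ltr0z subr_gt0 (le_lt_trans lS) // (lt_le_trans St) // lerDr.
    - by rewrite mem_iota => /= ks; apply: N2P.
  by rewrite -(all_map snd) degB.
have runB t : (N < t)%N -> bs_decomposition m.+1 (ci_betti (rcons a t)) (B t).
  by move=> Nt; apply: greedy_of_chain; [apply: chainB | apply: BE].
have elimB t : (N < t)%N -> elimination_order (ci_betti (rcons a t)) (B t) =
    [seq [fset x in E]%fset | E <- departures 0 (lifted id (+%R^~ t%:Z) m S (unzip2 s))].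
  move=> Nt; rewrite (elimination_order_chain _ _ _ (chainB t Nt) (BE t Nt)).
  by rewrite unzip2_lift_chain.
have sizeB t : size (B t) = (size s + (m.-1 + size s))%N by apply: size_lift_chain.
exists B; first by move=> t _ /runB.
split.
- by exists (size s + (m.-1 + size s))%N => t _ _.
- move=> t _ Nt; have [_ St _ _] := large t Nt; rewrite elimB //.
  have [E [R [-> ER]]] := departures_first_lift m S t (unzip2 s) a0 ds0 dds d0 dS St.
  rewrite /compatible size_map size_departures map_cat map_rcons map_take.
  have -> : [fset x in E]%fset = [fset (m, S)]%fset.
    by apply/fsetP => x; rewrite !inE /= ER inE.
  exact: prefix_prefix.
(* The sets F_k are the departures of the same chain written in symbolic degrees, the boolean
   recording whether t is to be added. Taking [absz] is harmless, since all degrees of the original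
   chain are nonnegative. *)
- pose lo j := (absz j, false); pose hi j := (absz j, true).
  exists [seq [fset x in [seq (x.1, x.2.1, x.2.2) | x <- E]]%fset
         | E <- departures (0%N, false) (lifted lo hi m S (unzip2 s))] => t _ Nt.
  have [_ St _ _] := large t Nt; rewrite elimB //.
  have -> : lifted id (+%R^~ t%:Z) m S (unzip2 s) =
      map (map (instantiate t)) (lifted lo hi m S (unzip2 s)).
    rewrite map_lifted; apply: eq_lifted Pds; rewrite ?inE ?lexx //.
    + by move=> j /andP[j0 _]; rewrite /instantiate /= addn0 gez0_abs.
    + by move=> j /andP[j0 _]; rewrite /instantiate /= mul1n PoszD gez0_abs.
  have t0 : (0 < t)%N by rewrite (leq_ltn_trans _ Nt).
  (* The default degree also has to be the value of a symbol before [departures_map] can be used;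
     injectivity is available because the symbols are bounded by S < t. *)
  rewrite -[0]/(instantiate t (0%N, false)).
  rewrite (departures_map _ _ _ _ (instantiate_inj t)) //; last first.
    apply: (all_lifted _ _ [pred j : int | 0 <= j <= S]) Pds; rewrite ?inE ?lexx //.
    move=> j /andP[j0 jS]; rewrite /= andbb -ltz_nat gez0_abs //.
    exact: le_lt_trans St.
  by rewrite -!map_comp; apply: eq_map => E; rewrite /= shift_positionsE.
move=> k ks; exists (((unzip1 s)`_k)%:P * 'X + (y`_k)%:P).
(* The k-th coefficient from the end belongs to the raised copy of the term with index [k'], counted
   from the front, whence the constant taken from [w]. *)
pose k' := (size s - k.+1)%N; have k's : (k' < size s)%N.
  by rewrite ltn_subrL (leq_ltn_trans _ ks).
exists (((unzip1 s)`_k')%:P * 'X + (w`_k')%:P).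
split; [by rewrite size_linear ?gt_eqF ?z0 | by rewrite size_linear ?gt_eqF ?z0 |].
move=> t _ _; rewrite !hornerE; split.
  rewrite /bs_coefficients /unzip1 map_cat nth_cat !size_map size_iota ks.
  by rewrite -map_comp (nth_map 0%N) ?size_iota // nth_iota.
rewrite /bs_coefficients nth_rev size_map sizeB ?ltn_addr //.
rewrite /unzip1 !map_cat !nth_cat !size_map size_rev !size_iota.
have -> : (size s + (m.-1 + size s) - k.+1 = size s + (m.-1 + k'))%N.
  by rewrite !addnA addnBA.
rewrite ltnNge leq_addr /= addKn ltnNge leq_addr /= addKn.
by rewrite -map_comp (nth_map 0%N) ?size_iota // nth_iota.
Qed.
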